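(* Let $\alpha$ and $\beta$ be inner functions such that the model space $K_{\alpha}$ has finite dimension $m>0$ and the model space $K_{\beta}$ has finite dimension $n>0$. Then the complex vector space $\mathscr{T}(\alpha,\beta)$ of all bounded asymmetric truncated Toeplitz operators from $K_\alpha$ into $K_\beta$ has dimension $m+n-1$.
   Context: $H^2$ is the classical Hardy space of the unit disk $\mathbb{D}$, identified via boundary values with a closed subspace of $L^2(\partial\mathbb{D})$. An inner function $\alpha$ is a bounded analytic function on $\mathbb{D}$ with $|\alpha|=1$ a.e. on $\partial\mathbb{D}$. The model space of $\alpha$ is $K_{\alpha}=H^2\ominus\alpha H^2$; $P_{\alpha}$ denotes the orthogonal projection from $L^2(\partial\mathbb{D})$ onto $K_\alpha$. (The space $K_\alpha$ has finite dimension $m$ if and only if $\alpha$ is a finite Blaschke product of degree $m$; in that case all functions in $K_\alpha$ are bounded.) For inner functions $\alpha,\beta$ and a symbol $\varphi\in L^2(\partial\mathbb{D})$, the asymmetric truncated Toeplitz operator $A_{\varphi}^{\alpha,\beta}$ is the (densely defined) operator from $K_\alpha$ into $K_\beta$ given by $A_{\varphi}^{\alpha,\beta}f=P_{\beta}(\varphi f)$; when $K_\alpha$ is finite-dimensional it is defined on all of $K_\alpha$. Set $$\mathscr{T}(\alpha,\beta)=\{A_{\varphi}^{\alpha,\beta}\colon \varphi\in L^2(\partial\mathbb{D})\text{ and }A_{\varphi}^{\alpha,\beta}\text{ is bounded}\}.$$ *)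

(* Defs.v *)
From HB Require Import structures.
From mathcomp Require Import all_boot all_order all_algebra.
From mathcomp Require Import generic_quotient complex.
From mathcomp Require Import all_classical all_reals all_analysis.

Set Implicit Arguments.
Unset Strict Implicit.
Unset Printing Implicit Defensive.

Import Order.TTheory GRing.Theory Num.Theory numFieldNormedType.Exports.

Local Open Scope classical_set_scope.
Local Open Scope quotient_scope.
Local Open Scope ring_scope.
Local Open Scope complex_scope.

Definition has_dimension (K : fieldType) (V : lmodType K) (S : set V) (n : nat) :=
  exists e : 'I_n -> V,
    (forall c : 'I_n -> K, \sum_(i < n) c i *: e i = 0 -> forall i, c i = 0) /\
    S = [set v | exists c : 'I_n -> K, v = \sum_(i < n) c i *: e i].

Section L2Circle.
Context {R : realType}.

Lemma pi2_gt0 : (0 : R) < 2 * pi.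
Proof. by rewrite mulr_gt0// pi_gt0. Qed.

(* Functions on the unit circle are written as functions of the angle t, which
   stands for the point e^{it}; only the values on [0, 2 pi] matter.
   Normalized arc length becomes the uniform probability on [0, 2 pi]. *)
Definition arclength : probability (measurableTypeR R) R := uniform_prob pi2_gt0.

Definition expi (t : R) : R[i] := cos t +i* sin t.

Let LR (f : R -> R) := (f : measurableTypeR R -> R) \in Lfun arclength 2%:E.

(* R[i]^o is R[i] with its canonical topology and structure of vector space
   over R[i]. *)
Definition sqintegrable : {pred R -> R[i]^o} :=
  [pred f : R -> R[i]^o |
    (((fun t => complex.Re (f t)) : measurableTypeR R -> R)
       \in Lfun arclength 2%:E) &&
    (((fun t => complex.Im (f t)) : measurableTypeR R -> R)
       \in Lfun arclength 2%:E)].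

Lemma sqintegrable_submod_closed : submod_closed sqintegrable.
Proof.
have [L0 LD] := @Lfun_submod_closed _ (measurableTypeR R) R arclength 2%:E
  (lee1n 2).
have LZ (a : R) f : LR f -> LR (fun t => a * f t).
  by move=> fL; have := LD a f 0 fL L0; rewrite addr0.
have LA f g : LR f -> LR g -> LR (fun t => f t + g t).
  by move=> fL gL; have := LD 1 f g fL gL; rewrite scale1r.
split=> [|a f g /andP[f1 f2] /andP[g1 g2]]; first by apply/andP; split.
apply/andP; split.
- have -> : (fun t => complex.Re ((a *: f + g) t)) = (fun t =>
      (complex.Re a * complex.Re (f t) + (- complex.Im a) * complex.Im (f t)) +
      complex.Re (g t)).
    apply/funext => t; rewrite mulNr.
    change ((a *: f + g) t) with (a * f t + g t).
    by case: a (f t) (g t) => [? ?] [? ?] [? ?].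
  by apply: (LA) => //; apply: (LA); apply: (LZ).
- have -> : (fun t => complex.Im ((a *: f + g) t)) = (fun t =>
      (complex.Re a * complex.Im (f t) + complex.Im a * complex.Re (f t)) +
      complex.Im (g t)).
    apply/funext => t.
    change ((a *: f + g) t) with (a * f t + g t).
    by case: a (f t) (g t) => [? ?] [? ?] [? ?].
  by apply: (LA) => //; apply: (LA); apply: (LZ).
Qed.

HB.instance Definition _ := GRing.isSubmodClosed.Build _ _ sqintegrable
  sqintegrable_submod_closed.

Record L2fun := MkL2fun {
  L2fun_val :> R -> R[i]^o;
  _ : L2fun_val \in sqintegrable }.

HB.instance Definition _ := [isSub for L2fun_val].
HB.instance Definition _ := [Choice of L2fun by <:].
HB.instance Definition _ := [SubChoice_isSubLmodule of L2fun by <:].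

Definition L2null : {pred L2fun} :=
  mem [set f : L2fun | {ae arclength, forall t, f t = 0}].

Lemma L2null_zmod_closed : zmod_closed L2null.
Proof.
have aeF := ae_filter_ringOfSetsType arclength.
split=> [|f g]; first by apply/mem_set/aeW.
move=> /set_mem f0 /set_mem g0; apply/mem_set; apply: filterS2 f0 g0 => t f0 g0.
by change (f t - g t = 0); rewrite f0 g0 subr0.
Qed.

HB.instance Definition _ :=
  GRing.isZmodClosed.Build _ L2null L2null_zmod_closed.

Definition L2 := Quotient.quot L2null.

HB.instance Definition _ := EqQuotient.on L2.
HB.instance Definition _ := GRing.Zmodule.on L2.

Definition L2scale (a : R[i]) (f : L2) : L2 := \pi_L2 (a *: repr f).

Lemma pi_L2E (f g : L2fun) : \pi_L2 f = \pi_L2 g <-> f - g \in L2null.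
Proof.
by split=> [/eqP|H]; [|apply/eqP; move: H]; rewrite Quotient.idealrBE.
Qed.

Lemma L2nullZ a (f : L2fun) : f \in L2null -> a *: f \in L2null.
Proof.
have aeF := ae_filter_ringOfSetsType arclength.
move=> /set_mem f0; apply/mem_set; apply: filterS f0 => t f0.
by change (a *: f t = 0); rewrite f0 scaler0.
Qed.

Lemma pi_L2D (f g : L2fun) : \pi_L2 (f + g) = \pi_L2 f + \pi_L2 g.
Proof. exact: Quotient.pi_add. Qed.

Lemma pi_L2Z a (f : L2fun) : \pi_L2 (a *: f) = L2scale a (\pi_L2 f).
Proof.
apply/pi_L2E; rewrite -scalerBr; apply: L2nullZ.
by apply/pi_L2E; rewrite reprK.
Qed.

Let L2scaleA a b f : L2scale a (L2scale b f) = L2scale (a * b) f.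
Proof. by elim/(@quotW _ L2): f => f; rewrite -!pi_L2Z scalerA. Qed.

Let L2scale1 : left_id 1 L2scale.
Proof. by elim/(@quotW _ L2) => f; rewrite -pi_L2Z scale1r. Qed.

Let L2scaleDr : right_distributive L2scale +%R.
Proof.
move=> a; elim/(@quotW _ L2) => f; elim/(@quotW _ L2) => g.
by rewrite -pi_L2D -!pi_L2Z -pi_L2D scalerDr.
Qed.

Let L2scaleDl f : {morph L2scale^~ f : a b / a + b}.
Proof.
by elim/(@quotW _ L2): f => f a b; rewrite -!pi_L2Z -pi_L2D scalerDl.
Qed.

HB.instance Definition _ := GRing.Zmodule_isLmodule.Build R[i] L2
  L2scaleA L2scale1 L2scaleDr L2scaleDl.

Definition L2rep (f : L2) : R -> R[i]^o := repr f.

Definition inner_product (f g : L2) : R[i] :=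
  (\int[arclength]_t complex.Re (L2rep f t * (L2rep g t)^*)) +i*
  (\int[arclength]_t complex.Im (L2rep f t * (L2rep g t)^*)).

Definition L2norm (f : L2) : R := Num.sqrt (complex.Re (inner_product f f)).

(* For a closed subspace S (in particular for a finite-dimensional one), the
   orthogonal projection onto S. *)
Definition orthogonal_projection (S : set L2) (f : L2) : L2 :=
  xget 0 [set g | S g /\ forall h, S h -> inner_product (f - g) h = 0].

(* The values of functions on the disk outside |z| < 1 are irrelevant. *)
Definition power_series_on_disk (a : nat -> R[i]) (f : R[i] -> R[i]^o) :=
  forall z : R[i], `|z| < 1 ->
    series (fun n => a n * z ^+ n : R[i]^o) @ \oo --> f z.

Definition analytic_on_disk (f : R[i] -> R[i]^o) :=
  exists a, power_series_on_disk a f.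

Definition radial_limit (f : R[i] -> R[i]^o) (t : R) (w : R[i]^o) :=
  f (r%:C * expi t) @[r --> (1 : R)^'-] --> w.

Definition inner_function (alpha : R[i] -> R[i]^o) :=
  [/\ analytic_on_disk alpha,
      (exists M : R, forall z, `|z| < 1 -> `|alpha z| <= M%:C) &
      {ae arclength, forall t, exists2 w, `|w| = 1 & radial_limit alpha t w}].

(* With normc valued in R; `|a n| is an element of R[i]. *)
Definition hardy_disk : set (R[i] -> R[i]^o) :=
  [set f | exists2 a, power_series_on_disk a f &
                      cvgn (series (fun n => Normc.normc (a n) ^+ 2))].

Definition boundary_value (f : R[i] -> R[i]^o) (g : L2) :=
  {ae arclength, forall t, radial_limit f t (L2rep g t)}.

Definition H2 : set L2 := [set g | exists2 f, hardy_disk f & boundary_value f g].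

Definition mul_H2 (alpha : R[i] -> R[i]^o) : set L2 :=
  [set g | exists2 h, hardy_disk h &
                      boundary_value (fun z => alpha z * h z) g].

Definition model_space (alpha : R[i] -> R[i]^o) : set L2 :=
  [set f | H2 f /\ forall g, mul_H2 alpha g -> inner_product f g = 0].

(* ATTO beta phi f g: the operator f |-> P_beta (phi f), defined at those f for
   which phi f is square integrable, maps f to g. *)
Definition ATTO (beta : R[i] -> R[i]^o) (phi f g : L2) :=
  exists2 h : L2, {ae arclength, forall t, L2rep h t = L2rep phi t * L2rep f t} &
                  g = orthogonal_projection (model_space beta) h.

Definition bounded_operator (S S' : set L2) (A : S -> L2) :=
  [/\ (forall f, S' (A f)),
      (forall (a : R[i]) (f g h : S),
         val h = a *: val f + val g -> A h = a *: A f + A g) &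
      exists M : R, forall f, L2norm (A f) <= M * L2norm (val f)].

(* The domain of ATTO beta phi contains the bounded functions of K_alpha, which
   are dense in K_alpha (and are all of K_alpha when it has finite dimension);
   a bounded ATTO is identified with its continuous extension to K_alpha. *)
Definition ATTO_space (alpha beta : R[i] -> R[i]^o) :
    set (model_space alpha -> L2) :=
  [set A | bounded_operator (model_space beta) A /\
           exists phi : L2, forall f g, ATTO beta phi (val f) g -> A f = g].

End L2Circle.
Arguments ATTO_space {R} alpha beta.
Arguments bounded_operator {R} S S' A.
Arguments L2fun : clear implicits.
Arguments L2 : clear implicits.

(* Main.v *)
Require Import Defs.
From mathcomp Require Import all_boot all_order all_algebra complex.
From mathcomp Require Import generic_quotient.
From mathcomp Require Import all_classical all_reals all_analysis.
From mathcomp Require Import measurable_realfun.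
From mathcomp Require Import ring lra zify.

(** The theorem follows from an explicit description of a finite-dimensional
    model space, in which a truncated Toeplitz operator has a Toeplitz matrix;
    the Toeplitz matrices with n rows and m columns form a space of dimension
    m + n - 1.

    The description rests on the backward shift S f = (f - f(0)) / z, which maps
    a model space to itself ([backward_shift_model_space]). The point needing
    analysis is that f(0) is the mean of the boundary values of f, for a Hardy
    function and also for the product of a bounded analytic function and a Hardy
    function ([mean_mul_hardy]). Both are obtained from a single fact: under a
    uniform bound on L2 norms, means pass to almost everywhere limits
    ([sqint_le_limit]).

    Let e be a basis of the model space, M the matrix of S in this basis, and
    w = 1 / z on the circle. The definition of S reads (w - M) e = w a for a
    constant vector a, so by Cramer's rule chi(w) e is a polynomial vector in w,
    where chi is the characteristic polynomial of M. An eigenvalue of S has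
    modulus different from 1 ([shift_eigenvalue_circle]), so that chi(w) is
    bounded away from 0. Counting dimensions, the functions w^(i+1) / chi(w)
    form a basis ([rational_basis]). In particular all functions of the model
    space are bounded, and the product of a symbol with any of them is square
    integrable.

    Let f_i and g_j be these bases for alpha and beta. The inner product of
    phi f_i with g_j depends only on i - j, because f_i = w^i f_0 and
    g_j = w^j g_0 ([toeplitz_entry_diag]). It determines the operator, since
    projecting onto the second space does not change inner products with the g_j
    ([toeplitz_op_eq]). Conversely the elementary Toeplitz matrices come from
    the bounded symbols z^s D1 conj(D2), where D1 and D2 are the denominators
    of the two bases ([toeplitz_entry_symbol]). *)

Set Implicit Arguments.
Unset Strict Implicit.
Unset Printing Implicit Defensive.

Import Order.TTheory GRing.Theory Num.Theory numFieldNormedType.Exports.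

Local Open Scope classical_set_scope.
Local Open Scope quotient_scope.
Local Open Scope ring_scope.
Local Open Scope complex_scope.

(** * Measurable complex functions on the circle *)

Section ComplexFunctions.
Context {R : realType}.
Implicit Types (F G : R -> R[i]) (z w : R[i]).
Local Notation mu := (@arclength R).

Definition sqnorm z : R := complex.Re z ^+ 2 + complex.Im z ^+ 2.

Lemma sqnorm_ge0 z : 0 <= sqnorm z.
Proof. by rewrite addr_ge0 ?sqr_ge0. Qed.

Lemma sqnormM z w : sqnorm (z * w) = sqnorm z * sqnorm w.
Proof. by case: z w => a b [c d]; rewrite /sqnorm /=; ring. Qed.

Lemma sqnormJ z : sqnorm z^*%C = sqnorm z.
Proof. by case: z => a b; rewrite /sqnorm /=; ring. Qed.

Lemma sqnormE z : (sqnorm z)%:C = z * z^*%C.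
Proof. by case: z => a b; rewrite /sqnorm; simpc; congr (_ +i* _); ring. Qed.

Lemma sqnorm_normc z : sqnorm z = Normc.normc z ^+ 2.
Proof. by case: z => a b; rewrite /sqnorm /= sqr_sqrtr// addr_ge0 ?sqr_ge0. Qed.

Lemma sqnorm_eq0 z : (sqnorm z == 0) = (z == 0).
Proof.
case: z => a b; rewrite /sqnorm eq_complex /=.
by rewrite paddr_eq0 ?sqr_ge0// !sqrf_eq0.
Qed.

Lemma sqnormD_le z w : sqnorm (z + w) <= 2 * (sqnorm z + sqnorm w).
Proof.
case: z w => a b [c d]; rewrite /sqnorm /= -subr_ge0.
have -> : 2 * (a ^+ 2 + b ^+ 2 + (c ^+ 2 + d ^+ 2)) -
  ((a + c) ^+ 2 + (b + d) ^+ 2) = (a - c) ^+ 2 + (b - d) ^+ 2 by ring.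
by rewrite addr_ge0 ?sqr_ge0.
Qed.

Lemma RecD z w : complex.Re (z + w) = complex.Re z + complex.Re w.
Proof. by case: z w => [? ?] []. Qed.
Lemma ImcD z w : complex.Im (z + w) = complex.Im z + complex.Im w.
Proof. by case: z w => [? ?] []. Qed.
Lemma RecM z w :
  complex.Re (z * w) =
    complex.Re z * complex.Re w - complex.Im z * complex.Im w.
Proof. by case: z w => [? ?] []. Qed.
Lemma ImcM z w :
  complex.Im (z * w) =
    complex.Re z * complex.Im w + complex.Im z * complex.Re w.
Proof. by case: z w => [? ?] []. Qed.
Lemma RecJ z : complex.Re z^*%C = complex.Re z. Proof. by case: z. Qed.
Lemma ImcJ z : complex.Im z^*%C = - complex.Im z. Proof. by case: z. Qed.
Lemma complex_ext z w :
  complex.Re z = complex.Re w -> complex.Im z = complex.Im w -> z = w.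
Proof. by case: z w => [? ?] [? ?] /= -> ->. Qed.

Definition cmeasurable F :=
  measurable_fun [set: measurableTypeR R] (fun t => complex.Re (F t)) /\
  measurable_fun [set: measurableTypeR R] (fun t => complex.Im (F t)).

Lemma cmeasurable_cst z : cmeasurable (fun=> z).
Proof. by split; exact: measurable_cst. Qed.

Lemma cmeasurableD F G : cmeasurable F -> cmeasurable G ->
  cmeasurable (fun t => F t + G t).
Proof.
move=> [F1 F2] [G1 G2]; split.
  under eq_fun do rewrite RecD; exact: measurable_funD.
by under eq_fun do rewrite ImcD; exact: measurable_funD.
Qed.

Lemma cmeasurableM F G : cmeasurable F -> cmeasurable G ->
  cmeasurable (fun t => F t * G t).
Proof.
move=> [F1 F2] [G1 G2]; split.
  under eq_fun do rewrite RecM.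
  by apply: measurable_funB; exact: measurable_funM.
under eq_fun do rewrite ImcM.
by apply: measurable_funD; exact: measurable_funM.
Qed.

Lemma cmeasurableJ F : cmeasurable F -> cmeasurable (fun t => (F t)^*%C).
Proof.
move=> [F1 F2]; split; first by under eq_fun do rewrite RecJ.
under eq_fun do rewrite ImcJ.
exact: (measurableT_comp (@oppr_measurable R setT)).
Qed.

Lemma cmeasurable_sum (I : Type) (s : seq I) (F : I -> R -> R[i]) :
  (forall i, cmeasurable (F i)) -> cmeasurable (fun t => \sum_(i <- s) F i t).
Proof.
move=> mF; elim: s => [|i s IH].
  by under eq_fun do rewrite big_nil; exact: cmeasurable_cst.
by under eq_fun do rewrite big_cons; exact: cmeasurableD.
Qed.

Lemma cmeasurable_exp F n : cmeasurable F -> cmeasurable (fun t => F t ^+ n).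
Proof.
move=> mF; elim: n => [|n IH].
  by under eq_fun do rewrite expr0; exact: cmeasurable_cst.
by under eq_fun do rewrite exprS; exact: cmeasurableM.
Qed.

Lemma cmeasurable_sqn F : cmeasurable F ->
  measurable_fun [set: measurableTypeR R] (fun t => (sqnorm (F t))%:E).
Proof.
move=> [F1 F2]; apply/measurable_EFinP.
by apply: measurable_funD; exact: measurable_funX.
Qed.

Lemma cmeasurable_expi : cmeasurable (@expi R).
Proof.
split; rewrite /expi /=; apply: continuous_measurable_fun.
  exact: continuous_cos.
exact: continuous_sin.
Qed.

Lemma Lfun2P (f : R -> R) :
  measurable_fun [set: measurableTypeR R] f ->
  (\int[mu]_t ((f t) ^+ 2)%:E < +oo)%E ->
  (f : measurableTypeR R -> R) \in Lfun mu 2%:E.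
Proof.
move=> mf fi; rewrite inE; apply/andP; split; rewrite inE//=.
rewrite /finite_norm unlock /Lnorm poweR_lty//.
apply: le_lt_trans fi; apply: ge0_le_integral => //.
- by move=> x _; rewrite lee_fin powR_ge0.
- apply/measurable_EFinP.
  apply: (@measurableT_comp _ _ _ _ _ _ (fun x : R => x `^ 2)) => //.
  exact: measurableT_comp.
- by apply/measurable_EFinP; exact: measurable_funX.
- move=> x _; rewrite lee_fin powR_mulrn//.
  by rewrite real_normK ?num_real.
Qed.

(** All estimates below bound the integral of the squared modulus rather than
    the two real components separately. *)
Lemma sqintP F : (F : R -> R[i]^o) \in sqintegrable <->
  cmeasurable F /\ (\int[mu]_t (sqnorm (F t))%:E < +oo)%E.
Proof.
split.
- move=> /andP[f1 f2].
  have m1 : measurable_fun [set: measurableTypeR R] (fun t => complex.Re (F t)).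
    by have := sub_Lfun_mfun f1; rewrite inE.
  have m2 : measurable_fun [set: measurableTypeR R] (fun t => complex.Im (F t)).
    by have := sub_Lfun_mfun f2; rewrite inE.
  split => //.
  have := integrableD measurableT (Lfun2_integrable_sqr f1)
    (Lfun2_integrable_sqr f2).
  move=> /integrableP[_]; apply: le_lt_trans; apply: ge0_le_integral => //.
  + by move=> x _; rewrite lee_fin sqnorm_ge0.
  + exact: cmeasurable_sqn.
  + apply: measurableT_comp => //.
    by apply: emeasurable_funD; apply/measurable_EFinP; exact: measurable_funX.
  + by move=> x _; rewrite /= lee_fin ler_norm.
- move=> [[m1 m2] fi]; apply/andP; split; apply: Lfun2P => //;
    apply: le_lt_trans fi; apply: ge0_le_integral => //.
  + by move=> x _; rewrite lee_fin sqr_ge0.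
  + by apply/measurable_EFinP; exact: measurable_funX.
  + exact: cmeasurable_sqn.
  + by move=> x _; rewrite lee_fin lerDl sqr_ge0.
  + by move=> x _; rewrite lee_fin sqr_ge0.
  + by apply/measurable_EFinP; exact: measurable_funX.
  + exact: cmeasurable_sqn.
  + by move=> x _; rewrite lee_fin lerDr sqr_ge0.
Qed.

End ComplexFunctions.

(** * Limits under a uniform bound on the integral of the square *)

Section SquareBoundedLimits.
Context {R : realType} d (T : measurableType d) (mu : probability T R).
Implicit Types u v : T -> R.

Lemma sq_integrable u : measurable_fun setT u ->
  (\int[mu]_t ((u t) ^+ 2)%:E < +oo)%E -> mu.-integrable setT (EFin \o u).
Proof.
move=> mu_ ui.
have i2 : mu.-integrable setT (EFin \o (fun t => u t ^+ 2)).
  apply/integrableP; split; first exact/measurable_EFinP/measurable_funX.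
  apply: le_lt_trans ui; apply: ge0_le_integral => //.
  - by apply: measurableT_comp => //; apply/measurable_EFinP/measurable_funX.
  - exact/measurable_EFinP/measurable_funX.
  - by move=> t _ /=; rewrite lee_fin ger0_norm ?sqr_ge0.
have i1 := finite_measure_integrable_cst mu 1 measurableT.
apply: (le_integrable measurableT) (integrableD measurableT i1 i2) => //.
  exact/measurable_EFinP.
move=> t _ /=; rewrite lee_fin [leRHS]ger0_norm ?addr_ge0 ?sqr_ge0//.
have [a0|a0] := leP 0 (u t).
  by rewrite ger0_norm//; nra.
by rewrite ltr0_norm//; nra.
Qed.

(** Fatou's lemma, packaged for almost everywhere limits. *)
Lemma fatou_le (h : nat -> T -> R) v (C : R) :
  (forall k, measurable_fun setT (h k)) -> measurable_fun setT v ->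
  (forall k t, 0 <= h k t) -> (forall t, 0 <= v t) ->
  (forall k, (\int[mu]_t (h k t)%:E <= C%:E)%E) ->
  {ae mu, forall t, h k t @[k --> \oo] --> v t} ->
  (\int[mu]_t (v t)%:E <= C%:E)%E.
Proof.
move=> mh mv h0 v0 hC hv.
have mh' k : measurable_fun setT (EFin \o h k) by exact/measurable_EFinP.
have h0' k (t : T) : setT t -> (0 <= (EFin \o h k) t)%E by rewrite lee_fin.
have := fatou mu measurableT mh' h0'.
move=> F; apply: le_trans (le_trans F _); last first.
  rewrite limn_einf_lim; apply: lime_le; first exact: is_cvg_einfs.
  apply: nearW => n; apply: le_trans (hC n).
  by apply: ereal_inf_lbound; exists n => /=.
apply: ae_ge0_le_integral => //.
- by move=> t _; rewrite lee_fin.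
- exact/measurable_EFinP.
- move=> t _; rewrite limn_einf_lim; apply: lime_ge; first exact: is_cvg_einfs.
  by apply: nearW => n; apply: le_ereal_inf_tmp => _ [m /= _ <-];
    rewrite lee_fin.
- rewrite /limn_einf; apply: measurableT_comp => //.
  apply: (@measurable_fun_limn_esup _ _ _ _ (fun k t => (- (h k t)%:E)%E)) => k.
  by apply: measurableT_comp => //; exact/measurable_EFinP.
- apply: filterS hv => t hv _.
  have E : (EFin \o (h ^~ t)) @ \oo --> (v t)%:E.
    by apply: cvg_EFin => //; exact: nearW.
  suff -> : limn_einf ((fun k => EFin \o h k) ^~ t) = (v t)%:E by [].
  by have [] := cvg_limn_einf_sup E.
Qed.

(** A bound on the integrals of the squares gives uniform integrability: since
    |x| <= min(|x|, K) + x^2 / K, the integral of |u_k - v| is at most that of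
    min(|u_k - v|, K), which tends to 0 by bounded convergence, plus 4C / K,
    which is small for large K. *)
Lemma integral_cvg_of_sq_bounded (u : nat -> T -> R) v (C c : R) :
  (forall k, measurable_fun setT (u k)) -> measurable_fun setT v ->
  (forall k, (\int[mu]_t (u k t ^+ 2)%:E <= C%:E)%E) ->
  (\int[mu]_t (v t ^+ 2)%:E <= C%:E)%E ->
  {ae mu, forall t, u k t @[k --> \oo] --> v t} ->
  (forall k, \int[mu]_t (u k t) = c) -> \int[mu]_t v t = c.
Proof.
move=> mu_ mv uC vC uv uc.
have C0 : 0 <= C.
  rewrite -lee_fin; apply: le_trans vC; apply: integral_ge0 => t _.
  by rewrite lee_fin sqr_ge0.
have ui k : mu.-integrable setT (EFin \o u k).
  by apply: sq_integrable => //; apply: le_lt_trans (uC k) _; rewrite ltry.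
have vi : mu.-integrable setT (EFin \o v).
  by apply: sq_integrable => //; apply: le_lt_trans vC _; rewrite ltry.
pose w k t := `|u k t - v t|.
have mw k : measurable_fun setT (w k).
  by apply: measurableT_comp => //; exact: measurable_funB.
have key (K : R) : 0 < K -> `|c - \int[mu]_t v t| <= 4 * C / K.
  move=> K0.
  have mm k : measurable_fun setT (fun t => Num.min (w k t) K).
    by apply: measurable_minr => //; exact: measurable_cst.
  have lim0 : (\int[mu]_t (Num.min (w k t) K)%:E)%E @[k --> \oo] --> 0%E.
    have [] := @dominated_convergence _ _ _ mu setT measurableT
      (fun k t => (Num.min (w k t) K)%:E) (cst 0%E) (cst K%:E).
    - by move=> k; apply/measurable_EFinP; exact: mm.
    - exact: measurable_cst.
    - apply: filterS uv => t uvt _; apply: cvg_EFin; first exact: nearW.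
      suff : (fun k => Num.min (w k t) K) @ \oo --> Num.min (`|v t - v t|) K.
        by rewrite subrr normr0 min_l // ltW.
      apply: (@continuous2_cvg _ R R R _ _ (w ^~ t) (cst K)
        (fun a b : R => Num.min a b)).
      + exact: (@min_continuous _ R (`|v t - v t|, K)).
      + by apply: cvg_norm; apply: cvgB => //; exact: cvg_cst.
      + exact: cvg_cst.
    - exact: finite_measure_integrable_cst.
    - apply: aeW => t k _ /=; rewrite lee_fin ger0_norm.
        by rewrite ge_min lexx orbT.
      by rewrite le_min normr_ge0 ltW.
    - by rewrite integral0.
  (* 2 (u_k^2 + v^2) bounds (u_k - v)^2 and has integral at most 4C *)
  have bnd k : (`|c - \int[mu]_t v t|%:E <=
      \int[mu]_t (Num.min (w k t) K)%:E + (4 * C / K)%:E)%E.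
    rewrite -(uc k) -RintegralB//.
    have wi : mu.-integrable setT (EFin \o (fun t => u k t - v t)).
      exact: (integrableB measurableT (ui k) vi).
    apply: le_trans (_ : (\int[mu]_t (w k t)%:E <= _)%E).
      rewrite /w EFin_normr_Rintegral//; apply: le_trans;
        first exact: le_abse_integral (measurable_int _ wi).
      by [].
    apply: le_trans (_ : (\int[mu]_t ((Num.min (w k t) K)%:E +
        (2 / K)%:E * ((u k t ^+ 2)%:E + (v t ^+ 2)%:E)) <= _)%E).
      apply: ge0_le_integral => //.
      - by move=> t _; rewrite lee_fin normr_ge0.
      - exact/measurable_EFinP.
      - apply: emeasurable_funD; first exact/measurable_EFinP.
        apply: emeasurable_funM => //.
        by apply: emeasurable_funD; apply/measurable_EFinP/measurable_funX.
      - move=> t _.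
        suff : w k t <= Num.min (w k t) K + 2 / K * (u k t ^+ 2 + v t ^+ 2).
          by rewrite -lee_fin EFinD EFinM EFinD.
        rewrite /w.
        set a := u k t; set b := v t.
        have s0 : 0 <= 2 / K * (a ^+ 2 + b ^+ 2).
          by rewrite mulr_ge0 ?divr_ge0 ?addr_ge0 ?sqr_ge0 ?ltW.
        have [h|h] := leP (`|a - b|) K; first by rewrite lerDl.
        apply: le_trans (_ : 2 / K * (a ^+ 2 + b ^+ 2) <= _);
          last by rewrite lerDr ltW.
        rewrite mulrAC ler_pdivlMr//.
        apply: le_trans (_ : `|a - b| ^+ 2 <= _).
          by rewrite expr2 ler_pM2l ?ltW// (lt_trans K0 h).
        rewrite real_normK ?num_real// -subr_ge0.
        have -> : 2 * (a ^+ 2 + b ^+ 2) - (a - b) ^+ 2 = (a + b) ^+ 2 by ring.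
        exact: sqr_ge0.
    rewrite ge0_integralD//; first last.
    - apply: emeasurable_funM => //.
      by apply: emeasurable_funD; apply/measurable_EFinP/measurable_funX.
    - move=> t _; rewrite mule_ge0 ?adde_ge0 ?lee_fin ?sqr_ge0//.
      by rewrite divr_ge0 ?ltW.
    - exact/measurable_EFinP.
    - by move=> t _; rewrite lee_fin le_min normr_ge0 ltW.
    rewrite leeD2l// ge0_integralZl//; first last.
    - by rewrite lee_fin divr_ge0 ?ltW.
    - by move=> t _; rewrite adde_ge0 ?lee_fin ?sqr_ge0.
    - by apply: emeasurable_funD; apply/measurable_EFinP/measurable_funX.
    rewrite ge0_integralD//; first last.
    - exact/measurable_EFinP/measurable_funX.
    - by move=> t _; rewrite lee_fin sqr_ge0.
    - exact/measurable_EFinP/measurable_funX.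
    - by move=> t _; rewrite lee_fin sqr_ge0.
    apply: le_trans (_ : ((2 / K)%:E * (C%:E + C%:E) <= _)%E).
      apply: lee_wpmul2l; first by rewrite lee_fin divr_ge0 ?ltW.
      exact: leeD.
    by rewrite -EFinD -EFinM lee_fin le_eqVlt; apply/orP; left; apply/eqP; ring.
  rewrite -lee_fin.
  have L : (\int[mu]_t (Num.min (w k t) K)%:E + (4 * C / K)%:E)%E @[k --> \oo]
      --> (0 + (4 * C / K)%:E)%E.
    by apply: cvgeD => //; exact: cvg_cst.
  rewrite -[leRHS]add0e -(cvg_lim _ L)//; apply: lime_ge.
    by apply/cvg_ex; eexists; exact: L.
  by apply: nearW => k; exact: bnd.
apply/eqP; rewrite eq_sym -subr_eq0 -normr_le0; apply/ler_addgt0Pr => e e0.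
rewrite add0r.
have K0 : 0 < (4 * C + 1) / e by rewrite divr_gt0//; lra.
apply: le_trans (key _ K0) _.
rewrite invf_div mulrA ler_pdivrMr; last lra.
nra.
Qed.

End SquareBoundedLimits.

(** * Means of complex functions *)

Section Means.
Context {R : realType}.
Implicit Types (F G : R -> R[i]) (z w : R[i]) (t : R).
Local Notation mu := (@arclength R).

#[global] Instance ae_arclength_filter : Filter (nbhs (almost_everywhere mu)).
Proof. exact: ae_filter_ringOfSetsType. Qed.

Lemma cvg_Re (T : Type) (FF : set_system T) {fF : Filter FF}
  (u : T -> R[i]^o) w :
  u @ FF --> (w : R[i]^o) -> (fun k => complex.Re (u k)) @ FF --> complex.Re w.
Proof.
move=> /cvgrPdist_le uw; apply/cvgrPdist_le => e e0.
have := uw e%:C; rewrite ltcR => /(_ e0); apply: filterS => k.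
move=> h; rewrite -lecR; apply: le_trans h; apply: le_trans (normc_ge_Re _).
have -> // : complex.Re w - complex.Re (u k) = complex.Re (w - u k).
by case: (w) (u k) => [? ?] [? ?].
Qed.

Lemma cvg_Im (T : Type) (FF : set_system T) {fF : Filter FF}
  (u : T -> R[i]^o) w :
  u @ FF --> (w : R[i]^o) -> (fun k => complex.Im (u k)) @ FF --> complex.Im w.
Proof.
move=> uw; pose j : R[i] := 0 +i* (- 1).
have E z : complex.Im z = complex.Re (j * z).
  by rewrite RecM /= mul0r sub0r mulN1r opprK.
rewrite E; under eq_fun do rewrite E.
apply: (@cvg_Re _ _ _ (fun k => j * u k)); apply: cvgM; last exact: uw.
exact: cvg_cst.
Qed.

Definition mean F : R[i] :=
  (\int[mu]_t complex.Re (F t)) +i* (\int[mu]_t complex.Im (F t)).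

Definition cintegrable F :=
  mu.-integrable setT (EFin \o (fun t => complex.Re (F t))) /\
  mu.-integrable setT (EFin \o (fun t => complex.Im (F t))).

(** The bound is explicit because limits require it to be uniform. *)
Definition sqint_le (C : R) F :=
  cmeasurable F /\ (\int[mu]_t (sqnorm (F t))%:E <= C%:E)%E.

Lemma sqint_le_Re C F : sqint_le C F ->
  (\int[mu]_t (complex.Re (F t) ^+ 2)%:E <= C%:E)%E.
Proof.
move=> [mF]; apply: le_trans; apply: ge0_le_integral => //.
- by move=> x _; rewrite lee_fin sqr_ge0.
- by apply/measurable_EFinP; apply: measurable_funX; case: mF.
- exact: cmeasurable_sqn.
- by move=> x _; rewrite lee_fin lerDl sqr_ge0.
Qed.

Lemma sqint_le_Im C F : sqint_le C F ->
  (\int[mu]_t (complex.Im (F t) ^+ 2)%:E <= C%:E)%E.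
Proof.
move=> [mF]; apply: le_trans; apply: ge0_le_integral => //.
- by move=> x _; rewrite lee_fin sqr_ge0.
- by apply/measurable_EFinP; apply: measurable_funX; case: mF.
- exact: cmeasurable_sqn.
- by move=> x _; rewrite lee_fin lerDr sqr_ge0.
Qed.

(** The passage to the limit behind the whole analytic part: both a square bound
    and the value of the mean survive almost everywhere convergence. It serves
    for partial sums of power series on a fixed circle, and then for radial
    limits. *)
Lemma sqint_le_limit (F_ : nat -> R -> R[i]) G C c :
  (forall k, sqint_le C (F_ k)) -> (forall k, mean (F_ k) = c) ->
  cmeasurable G ->
  {ae mu, forall t, (F_ k t : R[i]^o) @[k --> \oo] --> (G t : R[i]^o)} ->
  sqint_le C G /\ mean G = c.
Proof.
move=> FC Fc mG FG.
have GC : sqint_le C G.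
  split => //; apply: (@fatou_le R _ (measurableTypeR R) mu
    (fun k t => sqnorm (F_ k t)) (fun t => sqnorm (G t))).
  - by move=> k; have [/cmeasurable_sqn/measurable_EFinP] := FC k.
  - by have /measurable_EFinP := cmeasurable_sqn mG.
  - by move=> k t; exact: sqnorm_ge0.
  - by move=> t; exact: sqnorm_ge0.
  - by move=> k; have [] := FC k.
  - apply: filterS FG => t FG; apply: cvgD; rewrite expr2;
      under eq_fun do rewrite expr2.
      by apply: cvgM; exact: cvg_Re.
    by apply: cvgM; exact: cvg_Im.
split => //; apply: complex_ext => /=.
- apply: (@integral_cvg_of_sq_bounded R _ (measurableTypeR R) mu
    (fun k t => complex.Re (F_ k t)) (fun t => complex.Re (G t)) C).
  + by move=> k; have [[]] := FC k.
  + by case: mG.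
  + by move=> k; exact: sqint_le_Re.
  + exact: sqint_le_Re GC.
  + by apply: filterS FG => t; exact: cvg_Re.
  + by move=> k; rewrite -(Fc k).
- apply: (@integral_cvg_of_sq_bounded R _ (measurableTypeR R) mu
    (fun k t => complex.Im (F_ k t)) (fun t => complex.Im (G t)) C).
  + by move=> k; have [[]] := FC k.
  + by case: mG.
  + by move=> k; exact: sqint_le_Im.
  + exact: sqint_le_Im GC.
  + by apply: filterS FG => t; exact: cvg_Im.
  + by move=> k; rewrite -(Fc k).
Qed.

Lemma cmeasurable_limit (F_ : nat -> R -> R[i]) G :
  (forall k, cmeasurable (F_ k)) ->
  (forall t, (F_ k t : R[i]^o) @[k --> \oo] --> (G t : R[i]^o)) ->
    cmeasurable G.
Proof.
move=> mF FG; split.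
- apply: (@measurable_fun_cvg _ (measurableTypeR R) R setT (fun k t =>
    complex.Re (F_ k t))).
  + by move=> k; have [] := mF k.
  + by move=> t _; apply: cvg_Re.
- apply: (@measurable_fun_cvg _ (measurableTypeR R) R setT (fun k t =>
    complex.Im (F_ k t))).
  + by move=> k; have [] := mF k.
  + by move=> t _; apply: cvg_Im.
Qed.

Lemma sqint_of_le C F : sqint_le C F -> (F : R -> R[i]^o) \in sqintegrable.
Proof.
by move=> [mF fi]; apply/sqintP; split => //; apply: le_lt_trans fi _;
  rewrite ltry.
Qed.

Lemma sqintM F G : (F : R -> R[i]^o) \in sqintegrable ->
  (G : R -> R[i]^o) \in sqintegrable -> cintegrable (fun t => F t * G t).
Proof.
move=> /andP[F1 F2] /andP[G1 G2].
have I (f g : R -> R) : (f : measurableTypeR R -> R) \in Lfun mu 2%:E ->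
   (g : measurableTypeR R -> R) \in Lfun mu 2%:E ->
   mu.-integrable setT (EFin \o (fun t => f t * g t)).
  by move=> fi gi; apply/Lfun1_integrable; exact: Lfun2_mul_Lfun1.
split.
  under eq_fun do rewrite RecM.
  exact: integrableB (I _ _ F1 G1) (I _ _ F2 G2).
under eq_fun do rewrite ImcM.
exact: integrableD (I _ _ F1 G2) (I _ _ F2 G1).
Qed.

Lemma sqint_le_bounded C F : cmeasurable F -> (forall t, sqnorm (F t) <= C) ->
  sqint_le C F.
Proof.
move=> mF FC; split => //.
apply: le_trans (_ : (\int[mu]_t (cst C%:E t) <= _)%E).
  apply: ge0_le_integral => //; last by move=> t _; rewrite lee_fin.
  - by move=> t _; rewrite lee_fin sqnorm_ge0.
  - exact: cmeasurable_sqn.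
by rewrite integral_cst//= probability_setT mule1.
Qed.

Lemma sqint_cst z : ((fun=> z) : R -> R[i]^o) \in sqintegrable.
Proof.
by apply: (sqint_of_le (C := sqnorm z)); apply: sqint_le_bounded.
Qed.

Lemma sqint_cintegrable F : (F : R -> R[i]^o) \in sqintegrable -> cintegrable F.
Proof.
move=> Fi; have := sqintM (sqint_cst 1) Fi.
by rewrite (_ : (fun t => 1 * F t) = F)//; apply/funext => t; rewrite mul1r.
Qed.

Lemma cintegrable0 : cintegrable (fun=> 0).
Proof. by apply: sqint_cintegrable; exact: sqint_cst. Qed.

Lemma cintegrableD F G : cintegrable F -> cintegrable G ->
  cintegrable (fun t => F t + G t).
Proof.
move=> [F1 F2] [G1 G2]; split.
  by under eq_fun do rewrite RecD; exact: integrableD F1 G1.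
by under eq_fun do rewrite ImcD; exact: integrableD F2 G2.
Qed.

Lemma cintegrableZ z F : cintegrable F -> cintegrable (fun t => z * F t).
Proof.
move=> [F1 F2]; split.
- under eq_fun do rewrite RecM.
  exact: integrableB (integrableZl _ _ F1) (integrableZl _ _ F2).
- under eq_fun do rewrite ImcM.
  exact: integrableD (integrableZl _ _ F2) (integrableZl _ _ F1).
Qed.

Lemma cintegrable_sum (I : Type) (s : seq I) (F : I -> R -> R[i]) :
  (forall i, cintegrable (F i)) -> cintegrable (fun t => \sum_(i <- s) F i t).
Proof.
move=> iF; elim: s => [|i s IH].
  by under eq_fun do rewrite big_nil; exact: cintegrable0.
by under eq_fun do rewrite big_cons; exact: cintegrableD.
Qed.

Lemma meanD F G : cintegrable F -> cintegrable G ->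
  mean (fun t => F t + G t) = mean F + mean G.
Proof.
move=> [F1 F2] [G1 G2]; apply: complex_ext; rewrite ?RecD ?ImcD /=.
  by under eq_Rintegral do rewrite RecD; exact: RintegralD.
by under eq_Rintegral do rewrite ImcD; exact: RintegralD.
Qed.

Lemma meanZ z F : cintegrable F -> mean (fun t => z * F t) = z * mean F.
Proof.
move=> [F1 F2]; apply: complex_ext; rewrite ?RecM ?ImcM /=.
  under eq_Rintegral do rewrite RecM.
  rewrite RintegralB//; [|exact: integrableZl F1|exact: integrableZl F2].
  by rewrite !RintegralZl.
under eq_Rintegral do rewrite ImcM.
rewrite RintegralD//; [|exact: integrableZl F2|exact: integrableZl F1].
by rewrite !RintegralZl.
Qed.

Lemma mean0 : mean (fun=> 0) = 0.
Proof.
by have := meanZ 0 cintegrable0; under eq_fun do rewrite mul0r; rewrite mul0r.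
Qed.

Lemma mean_sum (I : Type) (s : seq I) (F : I -> R -> R[i]) :
  (forall i, cintegrable (F i)) ->
  mean (fun t => \sum_(i <- s) F i t) = \sum_(i <- s) mean (F i).
Proof.
move=> iF; elim: s => [|i s IH].
  by under eq_fun do rewrite big_nil; rewrite big_nil mean0.
under eq_fun do rewrite big_cons.
by rewrite meanD// ?IH ?big_cons//; exact: cintegrable_sum.
Qed.

Lemma meanJ F : cintegrable F -> mean (fun t => (F t)^*%C) = (mean F)^*%C.
Proof.
move=> [F1 F2]; apply: complex_ext; rewrite /= ?RecJ ?ImcJ /=.
  by under eq_Rintegral do rewrite RecJ.
under eq_Rintegral do rewrite ImcJ -mulN1r.
by rewrite RintegralZl// mulN1r.
Qed.

Lemma mean_ae F G : cmeasurable F -> cmeasurable G ->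
  {ae mu, forall t, F t = G t} -> mean F = mean G.
Proof.
move=> [F1 F2] [G1 G2] FG; apply: complex_ext => /=; congr fine;
  apply: ae_eq_integral => //; try exact/measurable_EFinP.
- by apply: filterS FG => t -> _.
- by apply: filterS FG => t -> _.
Qed.

End Means.

(** * Trigonometric sums *)

Section TrigonometricSums.
Context {R : realType}.
Implicit Types (F G : R -> R[i]) (z w : R[i]) (t : R).
Local Notation mu := (@arclength R).

Lemma is_derive_trig (a b k x : R) :
  is_derive x 1 (fun t => t + a * sin (k * t) + b * cos (k * t))
    (1 + a * (cos (k * x) * k) + b * (- sin (k * x) * k)).
Proof.
have D : is_derive x (1 : R) (fun t : R => k * t) k.
  by have := is_deriveZ k (is_derive_id x (1 : R));
    rewrite /GRing.scale /= mulr1.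
have Ds := is_derive1_comp (is_derive_sin (k * x)) D.
have Dc := is_derive1_comp (is_derive_cos (k * x)) D.
exact: is_deriveD (is_deriveD (is_derive_id x (1 : R)) (is_deriveZ a Ds))
  (is_deriveZ b Dc).
Qed.

Lemma continuous_trig (a b c k : R) :
  continuous (fun t : R => c + a * cos (k * t) + b * sin (k * t)).
Proof.
move=> x; apply: cvgD; first apply: cvgD; first exact: cvg_cst.
  apply: cvgM; first exact: cvg_cst.
  apply: (continuous_comp (f := fun t : R => k * t) (g := @cos R)).
    exact: mulrl_continuous.
  exact: continuous_cos.
apply: cvgM; first exact: cvg_cst.
apply: (continuous_comp (f := fun t : R => k * t) (g := @sin R)).
  exact: mulrl_continuous.
exact: continuous_sin.
Qed.

(** The condition on the amplitudes makes 1 + a cos + b sin nonnegative, so that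
    its integral against the uniform law is a Lebesgue integral over [0, 2 pi],
    computed from a primitive whose oscillating part is periodic. *)
Lemma integral_trig (a b k : R) : `|a| + `|b| <= 1 -> k != 0 ->
  sin (k * (2 * pi)) = 0 -> cos (k * (2 * pi)) = 1 ->
  \int[mu]_t (a * cos (k * t) + b * sin (k * t)) = 0.
Proof.
move=> ab k0 sk ck.
pose f t := 1 + a * cos (k * t) + b * sin (k * t).
have f0 t : 0 <= f t.
  have h1 : `|a * cos (k * t)| <= `|a|.
    by rewrite normrM ler_piMr// ler_norml cos_geN1 cos_le1.
  have h2 : `|b * sin (k * t)| <= `|b|.
    by rewrite normrM ler_piMr// ler_norml sin_geN1 sin_le1.
  move: h1 h2; rewrite !ler_norml /f => /andP[h1 _] /andP[h2 _]; lra.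
have cf : continuous f by exact: continuous_trig.
have mf : measurable_fun setT f by exact: continuous_measurable_fun.
pose G t := t + (a / k) * sin (k * t) + (- b / k) * cos (k * t).
have DG (x : R) : is_derive x (1 : R) (G : R -> R) (f x).
  have -> : f x = 1 + (a / k) * (cos (k * x) * k) + (- b / k) * (- sin (k * x)
    * k).
    by rewrite /f; field.
  exact: is_derive_trig.
have cG : continuous G.
  move=> x; apply: differentiable_continuous.
  by apply/derivable1_diffP; have [] := DG x.
have fI : (\int[mu]_t (f t)%:E = 1)%E.
  rewrite integral_uniform//; last by apply/measurable_EFinP.
  rewrite (@continuous_FTC2 _ f G)//; last 4 first.
  - exact: pi2_gt0.
  - exact: continuous_subspaceT.
  - split.
    + by move=> x _; have [] := DG x.
    + by apply: cvg_at_right_filter; exact: cG.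
    + by apply: cvg_at_left_filter; exact: cG.
  - by move=> x _; rewrite derive1E; have [] := DG x.
  rewrite /G sk ck !mulr0 sin0 cos0 subr0 -EFinB -EFinM; congr EFin.
  have p0 : pi != 0 :> R by rewrite gt_eqF// pi_gt0.
  by move: (pi : R) p0 => p p0; field; rewrite k0 p0.
have fi : mu.-integrable setT (EFin \o f).
  apply/integrableP; split; first exact/measurable_EFinP.
  under eq_integral do rewrite /= ger0_norm//.
  by rewrite fI ltry.
have -> : (fun t => a * cos (k * t) + b * sin (k * t)) = (fun t =>
  f t - cst 1 t).
  by apply/funext => t; rewrite /f /=; ring.
rewrite RintegralB//; last exact: finite_measure_integrable_cst.
rewrite Rintegral_cst//= probability_setT /= mulr1.
by rewrite /Rintegral fI subrr.
Qed.

Lemma expiD s t : expi (s + t) = expi s * expi t.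
Proof.
rewrite /expi cosD sinD; simpc; congr (_ +i* _); ring.
Qed.

Lemma expi0 : expi 0 = 1 :> R[i].
Proof. by rewrite /expi cos0 sin0. Qed.

Lemma expiJ t : (expi t)^*%C = expi (- t).
Proof. by rewrite /expi cosN sinN. Qed.

Lemma sqnorm_expi t : sqnorm (expi t) = 1.
Proof. exact: cos2Dsin2. Qed.

Lemma norm_expi t : `|expi t| = 1.
Proof. by rewrite normc_def /= cos2Dsin2 sqrtr1. Qed.

Lemma expi_neq0 t : expi t != 0.
Proof. by rewrite -normr_eq0 norm_expi oner_eq0. Qed.

(** The monomial z^k on the unit circle, as a function of the angle; negative
    exponents give powers of the conjugate of z. *)
Definition zpow (k : int) t : R[i] := expi (k%:~R * t).

Lemma zpow0 t : zpow 0 t = 1.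
Proof. by rewrite /zpow mul0r expi0. Qed.

Lemma zpow1 t : zpow 1 t = expi t.
Proof. by rewrite /zpow mul1r. Qed.

Lemma zpowD k l t : zpow (k + l) t = zpow k t * zpow l t.
Proof. by rewrite /zpow rmorphD /= mulrDl expiD. Qed.

Lemma zpowJ k t : (zpow k t)^*%C = zpow (- k) t.
Proof. by rewrite /zpow expiJ rmorphN /= mulNr. Qed.

Lemma zpowV k t : zpow (- k) t = (zpow k t)^-1.
Proof.
apply: (mulfI (expi_neq0 (k%:~R * t))).
by rewrite -/(zpow k t) -zpowD subrr zpow0 divff// expi_neq0.
Qed.

Lemma zpowX (n : nat) t : expi t ^+ n = zpow n t.
Proof.
elim: n => [|n IH]; first by rewrite zpow0.
by rewrite exprS IH -zpow1 -zpowD intS.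
Qed.

Lemma sqnorm_zpow k t : sqnorm (zpow k t) = 1.
Proof. exact: sqnorm_expi. Qed.

Lemma cmeasurable_zpow k : cmeasurable (zpow k).
Proof.
case: k => n; last rewrite NegzE.
  by have := cmeasurable_exp n (@cmeasurable_expi R);
    under eq_fun do rewrite zpowX.
have -> : zpow (- (n.+1)%:Z) = (fun t => (zpow n.+1 t)^*%C).
  by apply/funext => t; rewrite zpowJ.
by apply: cmeasurableJ; have := cmeasurable_exp n.+1 (@cmeasurable_expi R);
  under eq_fun do rewrite zpowX.
Qed.

Lemma zpow_2pi (k : int) : zpow k (2 * pi) = 1.
Proof.
have e1 : expi (2 * pi) = 1 :> R[i].
  by rewrite /expi mulrC mulr_natr cos2pi sin2pi.
by case: k => n; rewrite ?NegzE ?zpowV -zpowX e1 expr1n ?invr1.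
Qed.

Lemma sqint_zpow k : (zpow k : R -> R[i]^o) \in sqintegrable.
Proof.
apply: (sqint_of_le (C := 1)); apply: sqint_le_bounded;
  first exact: cmeasurable_zpow.
by move=> t; rewrite sqnorm_zpow.
Qed.

Lemma cintegrable_zpow k : cintegrable (zpow k).
Proof. by apply: sqint_cintegrable; exact: sqint_zpow. Qed.

Lemma mean_cst z : mean (fun=> z) = z.
Proof.
by apply: complex_ext; rewrite /= Rintegral_cst//= probability_setT /= mulr1.
Qed.

Lemma mean_zpow k : mean (zpow k) = (k == 0)%:R.
Proof.
have [->|k0] := eqVneq k 0.
  have -> : zpow 0 = fun=> 1 by apply/funext => t; rewrite zpow0.
  by rewrite mean_cst.
have k0' : k%:~R != 0 :> R by rewrite intr_eq0.
have := zpow_2pi k; rewrite /zpow /expi => -[ck sk].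
apply: complex_ext => /=.
  rewrite -[RHS](integral_trig (a := 1) (b := 0) _ k0' sk ck).
    by apply: eq_Rintegral => t _; rewrite mul1r mul0r addr0.
  by rewrite normr1 normr0 addr0.
rewrite -[RHS](integral_trig (a := 0) (b := 1) _ k0' sk ck).
  by apply: eq_Rintegral => t _; rewrite mul1r mul0r add0r.
by rewrite normr1 normr0 add0r.
Qed.

Lemma mean_sqnorm F : cmeasurable F -> mean (fun t => F t * (F t)^*%C) =
  (\int[mu]_t sqnorm (F t))%:C.
Proof.
move=> mF; apply: complex_ext => /=.
  by apply: eq_Rintegral => t _; rewrite -sqnormE.
rewrite -[RHS](_ : \int[mu]_t (0 : R) = 0); last first.
  by rewrite Rintegral_cst//= mul0r.
by apply: eq_Rintegral => t _; rewrite -sqnormE.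
Qed.

Lemma sqint_le_Rintegral F : (F : R -> R[i]^o) \in sqintegrable ->
  sqint_le (\int[mu]_t sqnorm (F t)) F.
Proof.
move=> /sqintP[mF Fi]; split => //; rewrite /Rintegral fineK// ge0_fin_numE//.
by apply: integral_ge0 => t _; rewrite lee_fin sqnorm_ge0.
Qed.

Lemma cmeasurable_trigsum N (b : nat -> R[i]) :
  cmeasurable (fun t => \sum_(i < N) b i * expi t ^+ i).
Proof.
apply: cmeasurable_sum => i; apply: cmeasurableM; first exact: cmeasurable_cst.
by apply: cmeasurable_exp; exact: cmeasurable_expi.
Qed.

Lemma sqintD F G : (F : R -> R[i]^o) \in sqintegrable ->
  (G : R -> R[i]^o) \in sqintegrable ->
  ((fun t => F t + G t) : R -> R[i]^o) \in sqintegrable.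
Proof.
move=> Fi Gi; have [_ H] := @sqintegrable_submod_closed R.
by have := H 1 F G Fi Gi; rewrite scale1r.
Qed.

Lemma sqintMb C F G : cmeasurable F -> {ae mu, forall t, sqnorm (F t) <= C} ->
  (G : R -> R[i]^o) \in sqintegrable ->
  ((fun t => F t * G t) : R -> R[i]^o) \in sqintegrable.
Proof.
move=> mF FC /sqintP[mG Gi]; apply/sqintP; split; first exact: cmeasurableM.
apply: le_lt_trans (_ : (\int[mu]_t (`|C|%:E * (sqnorm (G t))%:E) < +oo)%E).
  apply: ae_ge0_le_integral => //.
  - by move=> t _; rewrite lee_fin sqnorm_ge0.
  - by apply: cmeasurable_sqn; exact: cmeasurableM.
  - by move=> t _; rewrite -EFinM lee_fin mulr_ge0 ?sqnorm_ge0.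
  - by apply: emeasurable_funM => //; exact: cmeasurable_sqn.
  - apply: filterS FC => t FC _; rewrite -EFinM lee_fin sqnormM.
    by apply: ler_wpM2r; [exact: sqnorm_ge0|apply: le_trans FC (ler_norm _)].
rewrite ge0_integralZl//.
- by rewrite lte_mul_pinfty.
- exact: cmeasurable_sqn.
- by move=> t _; rewrite lee_fin sqnorm_ge0.
Qed.

Lemma sqintZ z F : (F : R -> R[i]^o) \in sqintegrable ->
  ((fun t => z * F t) : R -> R[i]^o) \in sqintegrable.
Proof.
by apply: (@sqintMb (sqnorm z) (fun=> z)); [exact: cmeasurable_cst|exact: aeW].
Qed.

Lemma sqintJ F : (F : R -> R[i]^o) \in sqintegrable ->
  ((fun t => (F t)^*%C) : R -> R[i]^o) \in sqintegrable.
Proof.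
move=> /sqintP[mF Fi]; apply/sqintP; split; first exact: cmeasurableJ.
by under eq_integral do rewrite sqnormJ.
Qed.

Lemma sqint_sum (I : Type) (s : seq I) (F : I -> R -> R[i]) :
  (forall i, (F i : R -> R[i]^o) \in sqintegrable) ->
  ((fun t => \sum_(i <- s) F i t) : R -> R[i]^o) \in sqintegrable.
Proof.
move=> iF; elim: s => [|i s IH].
  by under eq_fun do rewrite big_nil; exact: sqint_cst.
by under eq_fun do rewrite big_cons; exact: sqintD.
Qed.

Lemma sqint_trigsum N (b : nat -> R[i]) :
  ((fun t => \sum_(i < N) b i * expi t ^+ i) : R -> R[i]^o) \in sqintegrable.
Proof.
apply: sqint_sum => i; apply: sqintZ; under eq_fun do rewrite zpowX.
exact: sqint_zpow.
Qed.

Lemma conjcM z w : (z * w)^*%C = z^*%C * w^*%C.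
Proof. exact: rmorphM. Qed.

Lemma conjcD z w : (z + w)^*%C = z^*%C + w^*%C.
Proof. exact: rmorphD. Qed.

Lemma conjc_sum (I : Type) (s : seq I) (f : I -> R[i]) :
  (\sum_(i <- s) f i)^*%C = \sum_(i <- s) (f i)^*%C.
Proof. exact: rmorph_sum. Qed.

(** It gives a square bound for the partial sums of a Hardy function, uniform in
    the number of terms and in the radius of the circle. *)
Lemma parseval N (b : nat -> R[i]) :
  sqint_le (\sum_(i < N) sqnorm (b i))
    (fun t => \sum_(i < N) b i * expi t ^+ i).
Proof.
set F := (fun t => _).
have Fi := sqint_trigsum N b : (F : R -> R[i]^o) \in sqintegrable.
have [mF _] := (sqintP F).1 Fi.
suff <- : \int[mu]_t sqnorm (F t) = \sum_(i < N) sqnorm (b i).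
  exact: sqint_le_Rintegral.
have := mean_sqnorm mF.
have -> : (fun t => F t * (F t)^*%C) = (fun t => \sum_(i < N) \sum_(j < N)
    (b i * (b j)^*%C) * zpow (i%:Z - j%:Z) t).
  apply/funext => t; rewrite /F conjc_sum mulr_suml; apply: eq_bigr => i _.
  rewrite mulr_sumr; apply: eq_bigr => j _.
  by rewrite !zpowX zpowD -zpowJ mulrACA -conjcM.
rewrite mean_sum; last first.
  by move=> i; apply: cintegrable_sum => j; apply: cintegrableZ;
    exact: cintegrable_zpow.
have E (i : 'I_N) : mean (fun t => \sum_(j < N)
    (b i * (b j)^*%C) * zpow (i%:Z - j%:Z) t) = (sqnorm (b i))%:C.
  rewrite mean_sum; last by move=> j; apply: cintegrableZ;
    exact: cintegrable_zpow.
  have E j : mean (fun t => b i * (b j)^*%C * zpow (i%:Z - j%:Z) t) =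
      b i * (b j)^*%C * (i == j :> nat)%:R.
    by rewrite meanZ ?mean_zpow ?subr_eq0//; exact: cintegrable_zpow.
  rewrite (bigD1 i)//= E eqxx mulr1 big1 ?addr0 ?sqnormE// => j ji.
  by rewrite E eq_sym (inj_eq val_inj) (negbTE ji) mulr0.
by rewrite (eq_bigr _ (fun i _ => E i)) -rmorph_sum => /complexI ->.
Qed.

End TrigonometricSums.

(** * The mean value property for products of disk functions *)

Section MeanValue.
Context {R : realType}.
Implicit Types (F G : R -> R[i]) (z w : R[i]) (t : R).
Local Notation mu := (@arclength R).

Lemma normE z : `|z| = (Normc.normc z)%:C.
Proof. by rewrite normc_def; case: z. Qed.

Lemma normc_ge0 z : 0 <= Normc.normc z.
Proof. by case: z => a b; exact: sqrtr_ge0. Qed.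

Lemma norm_radial (r t : R) : 0 <= r -> `|r%:C * expi t| = r%:C.
Proof.
by move=> r0; rewrite normrM norm_expi mulr1 ger0_norm// ler0c.
Qed.

Lemma sqnorm_le z (M : R) : `|z| <= M%:C -> sqnorm z <= M ^+ 2.
Proof.
rewrite normE lecR => zM; rewrite sqnorm_normc ler_sqr ?nnegrE ?normc_ge0//.
exact: le_trans (normc_ge0 z) zM.
Qed.

Lemma coef_bound (a : nat -> R[i]) (f : R[i] -> R[i]^o) (s : R) :
  power_series_on_disk a f -> 0 <= s < 1 ->
  exists2 K : R, 0 <= K & forall n, `|a n * (s%:C) ^+ n| <= K%:C.
Proof.
move=> af /andP[s0 s1].
have sn : `|s%:C : R[i]| < 1 by rewrite ger0_norm ?ler0c// ltcR.
have u0 := cvg_series_cvg_0 (cvgP _ (af _ sn)).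
pose v n := Normc.normc (a n * s%:C ^+ n).
have v0 : v @ \oo --> (0 : R).
  apply/cvgr0Pnorm_le => e e0.
  have e0' : (0 : R[i]) < e%:C by rewrite ltcR.
  move/cvgr0Pnorm_le : u0 => /(_ _ e0'); apply: filterS => n.
  by rewrite normE lecR ger0_norm ?normc_ge0.
have [K [_ HK]] := cvg_seq_bounded (cvgP _ v0).
have [K0|K0] := leP 0 (K + 1); last first.
  have := HK (K + 1); rewrite ltrDl ltr01 =>
    /(_ isT 0%N I) /(le_trans (normr_ge0 _)).
  by rewrite leNgt K0.
exists (K + 1) => // n; rewrite normE lecR.
have := HK (K + 1); rewrite ltrDl ltr01 => /(_ isT n I).
by apply: le_trans; exact: ler_norm.
Qed.

Definition radial_psum (a : nat -> R[i]) (r : R) N t : R[i] :=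
  \sum_(i < N) (a i * r%:C ^+ i) * expi t ^+ i.

Lemma radial_psumE a r N t :
  radial_psum a r N t = series (fun n => a n * (r%:C * expi t) ^+ n) N.
Proof.
rewrite /radial_psum /series /= big_mkord; apply: eq_bigr => i _.
by rewrite exprMn mulrA.
Qed.

Lemma cvg_radial_psum a (f : R[i] -> R[i]^o) (r t : R) :
  power_series_on_disk a f -> 0 <= r < 1 ->
  (radial_psum a r N t : R[i]^o) @[N --> \oo] --> f (r%:C * expi t).
Proof.
move=> af /andP[r0 r1]; under eq_fun do rewrite radial_psumE.
by apply: af; rewrite norm_radial// ltcR.
Qed.

(** For r < s < 1 the terms at radius s are bounded, so that the partial sums at
    radius r are dominated by a geometric series of ratio r / s. *)
Lemma radial_psum_bounded a (f : R[i] -> R[i]^o) (r : R) :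
  power_series_on_disk a f -> 0 <= r < 1 ->
  exists C : R, forall N t, sqnorm (radial_psum a r N t) <= C.
Proof.
move=> af /andP[r0 r1].
have [s [s0 s1 rs]] : exists s, [/\ 0 < s, s < 1 & r < s].
  by exists ((r + 1) / 2); split; lra.
have [K K0 HK] : exists2 K : R, 0 <= K & forall n, `|a n * (s%:C) ^+ n| <= K%:C.
  by apply: coef_bound af _; rewrite ltW.
pose q := r / s.
have q0 : 0 <= q by rewrite divr_ge0// ltW.
have q1 : q < 1 by rewrite ltr_pdivrMr// mul1r.
exists ((K / (1 - q)) ^+ 2) => N t; apply: sqnorm_le.
apply: le_trans (ler_norm_sum _ _ _) _.
apply: le_trans (_ : (K * \sum_(i < N) q ^+ i)%:C <= _); last first.
  rewrite lecR ler_wpM2l// -[leLHS](mulfK (x := 1 - q)); last first.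
    by rewrite subr_eq0 gt_eqF.
  rewrite ler_piMl ?invr_ge0 ?subr_ge0 ?(ltW q1)//.
  have := subrX1 q N; rewrite -opprB -[q - 1]opprB mulNr => /oppr_inj E.
  by rewrite mulrC -E lerBlDr lerDl exprn_ge0.
rewrite mulr_sumr rmorph_sum /=; apply: ler_sum => i _.
rewrite normrM normrX norm_expi expr1n mulr1.
have -> : r%:C = s%:C * q%:C :> R[i].
  by rewrite -rmorphM /= /q mulrC divfK// gt_eqF.
rewrite exprMn mulrA normrM [leRHS]rmorphM /=; apply: ler_pM => //.
by rewrite normrX rmorphXn /= ger0_norm ?ler0c.
Qed.

Lemma cmeasurable_radial_psum a r N : cmeasurable (radial_psum a r N).
Proof. exact: (cmeasurable_trigsum N (fun i => a i * r%:C ^+ i)). Qed.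

Lemma sqint_le_radial_psum a r N B : 0 <= r < 1 ->
  cvgn (series (fun n => Normc.normc (a n) ^+ 2)) ->
  B = limn (series (fun n => Normc.normc (a n) ^+ 2)) ->
  sqint_le B (radial_psum a r N).
Proof.
move=> /andP[r0 r1] ca ->.
have [mF] := parseval N (fun i => a i * r%:C ^+ i).
move=> le1; split => //; apply: le_trans le1 _; rewrite lee_fin.
apply: le_trans (nondecreasing_cvgn_le _ ca N); last first.
  by apply: nondecreasing_series => n _; rewrite sqr_ge0.
rewrite /series /= big_mkord; apply: ler_sum => i _.
rewrite -sqnorm_normc sqnormM ler_piMr ?sqnorm_ge0//.
rewrite sqnorm_normc -rmorphXn /= expr0n /= addr0 sqrtr_sqr real_normK
  ?num_real//.
by rewrite expr_le1 ?exprn_ge0// exprn_ile1// ltW.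
Qed.

Lemma mean_radial_psumM a b r N :
  mean (fun t => radial_psum a r N.+1 t * radial_psum b r N.+1 t) =
  a 0%N * b 0%N.
Proof.
have -> : (fun t => radial_psum a r N.+1 t * radial_psum b r N.+1 t) = (fun t =>
    \sum_(i < N.+1) \sum_(j < N.+1)
      (a i * r%:C ^+ i * (b j * r%:C ^+ j)) * zpow (i + j)%N t).
  apply/funext => t; rewrite mulr_suml; apply: eq_bigr => i _.
  rewrite mulr_sumr; apply: eq_bigr => j _.
  by rewrite !zpowX PoszD zpowD mulrACA.
rewrite mean_sum; last first.
  by move=> i; apply: cintegrable_sum => j; apply: cintegrableZ;
    exact: cintegrable_zpow.
have E (i : 'I_N.+1) : mean (fun t => \sum_(j < N.+1)
      (a i * r%:C ^+ i * (b j * r%:C ^+ j)) * zpow (i + j)%N t) =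
    if i == ord0 then a 0%N * b 0%N else 0.
  rewrite mean_sum; last by move=> j; apply: cintegrableZ;
    exact: cintegrable_zpow.
  have E j : mean (fun t =>
      (a i * r%:C ^+ i * (b j * r%:C ^+ j)) * zpow (i + j)%N t) =
      (a i * r%:C ^+ i * (b j * r%:C ^+ j)) * ((i + j)%N == 0%N)%:R.
    by rewrite meanZ ?mean_zpow//; exact: cintegrable_zpow.
  rewrite (bigD1 ord0)//= E big1 ?addr0; last first.
    move=> j j0; rewrite E addn_eq0 [X in _ && X](_ : _ = false) ?andbF
      ?mulr0//.
    exact: negbTE.
  rewrite addn0 expr0 mulr1; have [->|i0] := eqVneq i ord0.
    by rewrite expr0 !mulr1.
  by rewrite [nat_of_ord i == 0%N](negbTE i0) mulr0.
rewrite (eq_bigr _ (fun i _ => E i)) (bigD1 ord0)//= big1 ?addr0// => i.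
by move=> /negbTE ->.
Qed.

(** On a circle of radius r < 1 the product is a limit of products of partial
    sums, whose mean is the product of the constant terms; letting r tend to 1,
    the L2 norms on these circles stay below M times the Hardy norm of h, so
    the mean survives. *)
Lemma mean_mul_hardy (alpha h : R[i] -> R[i]^o) (a b : nat -> R[i]) (M : R) G :
  power_series_on_disk a alpha -> (forall z, `|z| < 1 -> `|alpha z| <= M%:C) ->
  power_series_on_disk b h ->
  cvgn (series (fun n => Normc.normc (b n) ^+ 2)) ->
  cmeasurable G ->
  {ae mu, forall t, radial_limit (fun z => alpha z * h z) t (G t)} ->
  mean G = a 0%N * b 0%N.
Proof.
move=> aa aM bh cb mG aG.
pose B := limn (series (fun n => Normc.normc (b n) ^+ 2)).
pose H (r : R) t : R[i] := h (r%:C * expi t).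
pose F (r : R) t : R[i] := alpha (r%:C * expi t) * h (r%:C * expi t).
have HB r : 0 <= r < 1 -> sqint_le B (H r).
  (* the mean of a partial sum is computed from its product with a partial sum
     of the constant series 1 *)
  move=> r01; apply: (proj1 (sqint_le_limit
    (F_ := fun N => radial_psum b r N.+1) (c := 1 * b 0%N) _ _ _ _)).
  - by move=> k; exact: sqint_le_radial_psum.
  - move=> k; rewrite -(mean_radial_psumM (fun i => (i == 0%N)%:R) b r k).
    congr mean; apply/funext => t.
    have -> : radial_psum (fun i => (i == 0%N)%:R) r k.+1 t = 1;
      last by rewrite mul1r.
    rewrite /radial_psum big_ord_recl /=.
    by rewrite expr0 !mulr1 big1 ?addr0// => i _; rewrite !mul0r.
  - apply: (cmeasurable_limit (F_ := radial_psum b r));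
      first exact: cmeasurable_radial_psum.
    by move=> t; exact: cvg_radial_psum.
  - apply: aeW => t; rewrite (cvg_shiftS (fun N =>
      radial_psum b r N t : R[i]^o)).
    exact: cvg_radial_psum.
have FB r : 0 <= r < 1 -> mean (F r) = a 0%N * b 0%N /\ cmeasurable (F r).
  move=> r01; have [C HC] := radial_psum_bounded aa r01.
  pose P N t := radial_psum a r N.+1 t * radial_psum b r N.+1 t.
  have PF t : (P N t : R[i]^o) @[N --> \oo] --> (F r t : R[i]^o).
    rewrite (cvg_shiftS (fun N => radial_psum a r N t * radial_psum b r N t :
      R[i]^o)).
    by apply: cvgM; exact: cvg_radial_psum.
  have mP N : cmeasurable (P N) by apply: cmeasurableM;
    exact: cmeasurable_radial_psum.
  have mF : cmeasurable (F r) by apply: (cmeasurable_limit (F_ := P)).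
  split; last exact: mF.
  apply: (proj2 (sqint_le_limit (F_ := P) (C := C * B) _ _ mF _)).
  - move=> k; split => //; have [mp Bp] := sqint_le_radial_psum k.+1 r01 cb
      (erefl B).
    apply: le_trans (_ : (\int[mu]_t (C%:E * (sqnorm (radial_psum b r k.+1
      t))%:E) <= _)%E).
      apply: ge0_le_integral => //.
      + by move=> t _; rewrite lee_fin sqnorm_ge0.
      + exact: cmeasurable_sqn.
      + by apply: emeasurable_funM => //; exact: cmeasurable_sqn.
      + move=> t _; rewrite -EFinM lee_fin sqnormM.
        by apply: ler_wpM2r; [exact: sqnorm_ge0|exact: HC].
    have C0 : 0 <= C by apply: le_trans (sqnorm_ge0 _) (HC 0%N 0).
    rewrite ge0_integralZl//; first last.
    - by move=> t _; rewrite lee_fin sqnorm_ge0.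
    - exact: cmeasurable_sqn.
    by rewrite [leRHS]EFinM; apply: lee_wpmul2l.
  - by move=> k; exact: mean_radial_psumM.
  - exact: aeW.
(* any sequence in [0, 1) tending to 1 would do *)
pose r (k : nat) : R := 1 - k.+2%:R^-1.
have r01 k : 0 <= r k < 1.
  rewrite subr_ge0 invf_le1 ?ltr0n// ler1n /= gtrDl oppr_lt0 invr_gt0 ltr0n.
  by [].
apply: (proj2 (sqint_le_limit (F_ := fun k => F (r k)) (C := M ^+ 2 * B)
  _ _ mG _)).
- move=> k; have [_ mF] := FB _ (r01 k); split => //.
  have [mH HBk] := HB _ (r01 k).
  apply: le_trans (_ : (\int[mu]_t ((M ^+ 2)%:E * (sqnorm (H (r k) t))%:E) <=
    _)%E).
    apply: ge0_le_integral => //.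
    + by move=> t _; rewrite lee_fin sqnorm_ge0.
    + exact: cmeasurable_sqn.
    + by apply: emeasurable_funM => //; exact: cmeasurable_sqn.
    + move=> t _; rewrite -EFinM lee_fin sqnormM.
      apply: ler_wpM2r; [exact: sqnorm_ge0|apply: sqnorm_le; apply: aM].
      by rewrite norm_radial ?ltcR; case/andP: (r01 k).
  rewrite ge0_integralZl ?lee_fin ?sqr_ge0//; first last.
  - by move=> t _; rewrite lee_fin sqnorm_ge0.
  - exact: cmeasurable_sqn.
  by rewrite [leRHS]EFinM; apply: lee_wpmul2l; rewrite ?lee_fin ?sqr_ge0.
- by move=> k; have [] := FB _ (r01 k).
- apply: filterS aG => t; apply: cvg_comp.
  have rk : r @ \oo --> (1 : R).
    have -> : 1 = 1 - 0 :> R by rewrite subr0.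
    apply: cvgB; first exact: cvg_cst.
    rewrite (cvg_shiftS (fun n => n.+1%:R^-1 : R)); exact: cvg_harmonic.
  move=> A [e e0 Ae]; have := rk; move/cvgrPdist_lt => /(_ _ e0).
  apply: filterS => k; move=> h1; apply: Ae => //=.
  by case/andP: (r01 k).
Qed.

End MeanValue.

(** * Representatives and inner products in L2 *)

Section L2Space.
Context {R : realType}.
Implicit Types (F G : R -> R[i]) (z w : R[i]) (t : R) (f g h : L2 R).
Local Notation mu := (@arclength R).

Lemma L2repP g : L2rep g \in sqintegrable.
Proof. exact: (valP (repr g)). Qed.

Lemma cmeasurable_L2rep g : cmeasurable (L2rep g).
Proof. by have /sqintP[] := L2repP g. Qed.

(** The class of F when F is square integrable, and 0 otherwise. *)
Definition toL2 F : L2 R := \pi_(L2 R) (insubd (0 : L2fun R) (F : R -> R[i]^o)).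

Lemma L2rep_pi (u : L2fun R) : {ae mu, forall t, L2rep (\pi_(L2 R) u) t = u t}.
Proof.
have /pi_L2E/set_mem : \pi_(L2 R) (repr (\pi_(L2 R) u)) = \pi_(L2 R) u.
  by rewrite reprK.
by apply: filterS => t /subr0_eq.
Qed.

Lemma L2rep_toL2 F : (F : R -> R[i]^o) \in sqintegrable ->
  {ae mu, forall t, L2rep (toL2 F) t = F t}.
Proof.
move=> FL; apply: filterS (L2rep_pi (insubd (0 : L2fun R) (F : R ->
  R[i]^o))) => t ->.
by have /= -> := insubdK (0 : L2fun R) FL.
Qed.

Lemma L2_ext f g : {ae mu, forall t, L2rep f t = L2rep g t} -> f = g.
Proof.
move=> fg; rewrite -[f]reprK -[g]reprK; apply/pi_L2E/mem_set.
apply: filterS fg => t fg.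
by change (repr f t - repr g t = 0); rewrite [repr f t]fg subrr.
Qed.

Lemma toL2_eq F f : (F : R -> R[i]^o) \in sqintegrable ->
  {ae mu, forall t, F t = L2rep f t} -> toL2 F = f.
Proof.
by move=> Fi Ff; apply: L2_ext; apply: filterS2 (L2rep_toL2 Fi) Ff => t -> ->.
Qed.

Lemma L2repD f g : {ae mu, forall t, L2rep (f + g) t = L2rep f t + L2rep g t}.
Proof.
have -> : f + g = \pi_(L2 R) (repr f + repr g) by rewrite pi_L2D !reprK.
exact: L2rep_pi.
Qed.

Lemma L2repZ a f : {ae mu, forall t, L2rep (a *: f) t = a * L2rep f t}.
Proof.
have -> : a *: f = \pi_(L2 R) (a *: repr f) by rewrite pi_L2Z reprK.
exact: L2rep_pi.
Qed.

Lemma L2rep0 : {ae mu, forall t, L2rep (0 : L2 R) t = 0}.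
Proof. by apply: filterS (L2repZ 0 0) => t; rewrite scale0r mul0r. Qed.

Lemma L2rep_sum (I : Type) (s : seq I) (f : I -> L2 R) :
  {ae mu, forall t, L2rep (\sum_(i <- s) f i) t = \sum_(i <- s) L2rep (f i) t}.
Proof.
elim: s => [|i s IH].
  by rewrite big_nil; apply: filterS L2rep0 => t ->; rewrite big_nil.
rewrite big_cons; apply: filterS2 (L2repD (f i) (\sum_(j <- s) f j)) IH => t ->
  ->.
by rewrite big_cons.
Qed.

Lemma L2rep_lincomb n (c : 'I_n -> R[i]) (f : 'I_n -> L2 R) :
  {ae mu, forall t,
    L2rep (\sum_(i < n) c i *: f i) t = \sum_(i < n) c i * L2rep (f i) t}.
Proof.
have H : {ae mu, forall t, forall i, L2rep (c i *: f i) t = c i * L2rep (f i)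
  t}.
  apply: (@filter_forall (measurableTypeR R) _
    (fun i => [set t | L2rep (c i *: f i) t = c i * L2rep (f i) t])) => i.
  exact: L2repZ.
apply: filterS2 (L2rep_sum (index_enum _) (fun i => c i *: f i)) H => t -> H.
exact: eq_bigr.
Qed.

Lemma inner_ae f g F G : cmeasurable F -> cmeasurable G ->
  {ae mu, forall t, L2rep f t = F t} -> {ae mu, forall t, L2rep g t = G t} ->
  inner_product f g = mean (fun t => F t * (G t)^*%C).
Proof.
move=> mF mG fF gG; apply: mean_ae.
- by apply: cmeasurableM; [|apply: cmeasurableJ]; exact: cmeasurable_L2rep.
- by apply: cmeasurableM => //; exact: cmeasurableJ.
- by apply: filterS2 fF gG => t -> ->.
Qed.

Lemma innerE f g :
  inner_product f g = mean (fun t => L2rep f t * (L2rep g t)^*%C).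
Proof. by []. Qed.

Lemma cintegrable_inner f g :
  cintegrable (fun t => L2rep f t * (L2rep g t)^*%C).
Proof. by apply: sqintM; [|apply: sqintJ]; exact: L2repP. Qed.

Lemma innerDl f g h :
  inner_product (f + g) h = inner_product f h + inner_product g h.
Proof.
rewrite !innerE -meanD; try exact: cintegrable_inner.
rewrite -innerE (@inner_ae _ _ (fun t => L2rep f t + L2rep g t) (L2rep h)).
- by congr mean; apply/funext => t; rewrite mulrDl.
- by apply: cmeasurableD; exact: cmeasurable_L2rep.
- exact: cmeasurable_L2rep.
- exact: L2repD.
- exact: aeW.
Qed.

Lemma innerZl a f h : inner_product (a *: f) h = a * inner_product f h.
Proof.
rewrite !innerE -meanZ; last exact: cintegrable_inner.
rewrite -innerE (@inner_ae _ _ (fun t => a * L2rep f t) (L2rep h)).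
- by congr mean; apply/funext => t; rewrite mulrA.
- by apply: cmeasurableM; [exact: cmeasurable_cst|exact: cmeasurable_L2rep].
- exact: cmeasurable_L2rep.
- exact: L2repZ.
- exact: aeW.
Qed.

Lemma innerC f g : inner_product g f = (inner_product f g)^*%C.
Proof.
rewrite !innerE -meanJ; last exact: cintegrable_inner.
by congr mean; apply/funext => t; rewrite conjcM conjcK mulrC.
Qed.

Lemma inner0l h : inner_product 0 h = 0.
Proof. by rewrite -(scale0r 0) innerZl mul0r. Qed.

Lemma innerBl f g h :
  inner_product (f - g) h = inner_product f h - inner_product g h.
Proof. by rewrite -scaleN1r innerDl innerZl mulN1r. Qed.

Lemma inner_suml n (c : 'I_n -> R[i]) (f : 'I_n -> L2 R) h :
  inner_product (\sum_(i < n) c i *: f i) h =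
  \sum_(i < n) c i * inner_product (f i) h.
Proof.
elim/big_rec2: _ => [|i x y _ IH]; first by rewrite inner0l.
by rewrite innerDl innerZl IH.
Qed.

Lemma innerDr f g h :
  inner_product h (f + g) = inner_product h f + inner_product h g.
Proof. by rewrite innerC innerDl conjcD -!innerC. Qed.

Lemma inner_sumr n (c : 'I_n -> R[i]) (f : 'I_n -> L2 R) h :
  inner_product h (\sum_(i < n) c i *: f i) =
  \sum_(i < n) (c i)^*%C * inner_product h (f i).
Proof.
rewrite innerC inner_suml conjc_sum; apply: eq_bigr => i _.
by rewrite conjcM -innerC.
Qed.

Definition sqL2norm f : R := \int[mu]_t sqnorm (L2rep f t).

Lemma inner_self f : inner_product f f = (sqL2norm f)%:C.
Proof. by rewrite innerE mean_sqnorm//; exact: cmeasurable_L2rep. Qed.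

Lemma sqL2norm_ge0 f : 0 <= sqL2norm f.
Proof. by apply: Rintegral_ge0 => t _; exact: sqnorm_ge0. Qed.

Lemma L2normE f : L2norm f = Num.sqrt (sqL2norm f).
Proof. by rewrite /L2norm inner_self. Qed.

Lemma sqL2norm_eq0 f : sqL2norm f = 0 -> f = 0.
Proof.
move=> f0; apply: L2_ext.
have [mF Fi] := (sqintP _).1 (L2repP f).
have : (\int[mu]_t (sqnorm (L2rep f t))%:E = 0)%E.
  have I0 : (0 <= \int[mu]_t (sqnorm (L2rep f t))%:E)%E.
    by apply: integral_ge0 => t _; rewrite lee_fin sqnorm_ge0.
  by rewrite -[LHS]fineK ?ge0_fin_numE//; congr EFin.
rewrite -[X in X = _](_ : (\int[mu]_t `|(sqnorm (L2rep f t))%:E| = _)%E);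
  last first.
  by apply: eq_integral => t _; rewrite gee0_abs// lee_fin sqnorm_ge0.
move/(ae_eq_integral_abs mu measurableT (cmeasurable_sqn mF)).
move=> H; apply: filterS2 H L2rep0 => t H ->.
by have [/eqP] := H I; rewrite sqnorm_eq0 => /eqP.
Qed.

End L2Space.

(** * The backward shift on a model space *)

Section BackwardShift.
Context {R : realType}.
Implicit Types (F G : R -> R[i]) (z w : R[i]) (t : R) (f g : L2 R).
Local Notation mu := (@arclength R).

Lemma cvg_series_shift (K : numFieldType) (V : normedModType K)
  (u : nat -> V) (l : V) :
  (fun n => series u n.+1) @ \oo --> l -> series u @ \oo --> l.
Proof. by rewrite -(cvg_shiftS (series u)). Qed.

Lemma power_series1 :
  power_series_on_disk (fun n => (n == 0%N)%:R) (fun=> 1 : R[i]^o).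
Proof.
move=> z _; apply: cvg_series_shift.
rewrite (_ : (fun n => _) = cst (1 : R[i]^o)); first exact: cvg_cst.
apply/funext => n; rewrite /series /= big_nat_recl//= expr0 mulr1.
by rewrite big1 ?addr0// => i _; rewrite mul0r.
Qed.

Lemma power_series_mulX b (h : R[i] -> R[i]^o) : power_series_on_disk b h ->
  power_series_on_disk (fun n => if n is n'.+1 then b n' else 0)
    (fun z => z * h z).
Proof.
move=> bh z z1; apply: cvg_series_shift.
rewrite (_ : (fun n => _) = (fun n => z * series (fun n =>
  b n * z ^+ n) n : R[i]^o)).
  by apply: cvgM; [exact: cvg_cst|exact: bh].
apply/funext => n; rewrite /series /= big_nat_recl//= mul0r add0r mulr_sumr.
by apply: eq_bigr => i _; rewrite exprS mulrCA.
Qed.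

Lemma summable_mulX (b : nat -> R[i]) :
  cvgn (series (fun n => Normc.normc (b n) ^+ 2)) ->
  cvgn (series (fun n =>
    Normc.normc (if n is n'.+1 then b n' else 0) ^+ 2)).
Proof.
move=> cb; apply/cvg_ex; exists (limn (series (fun n =>
  Normc.normc (b n) ^+ 2))).
apply: (@cvg_series_shift R R^o).
rewrite (_ : (fun n => _) = series (fun n => Normc.normc (b n) ^+ 2))//.
apply/funext => n; rewrite /series /= big_nat_recl//= expr0n /= addr0 sqrtr0.
by rewrite expr0n add0r.
Qed.

Lemma hardy_mulX (h : R[i] -> R[i]^o) : hardy_disk h ->
  hardy_disk (fun z => z * h z).
Proof.
move=> [b bh cb]; exists (fun n => if n is n'.+1 then b n' else 0).
  exact: power_series_mulX.
exact: summable_mulX.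
Qed.

(** The removable singularity at 0 is filled in with the next coefficient. *)
Lemma power_series_divX a (f : R[i] -> R[i]^o) : power_series_on_disk a f ->
  power_series_on_disk (fun n => a n.+1)
    (fun z => if z == 0 then a 1%N else (f z - a 0%N) / z).
Proof.
move=> af z z1; case: (eqVneq z 0) => [->|z0].
  apply: cvg_series_shift; rewrite (_ : (fun n => _) = cst (a 1%N : R[i]^o));
    first exact: cvg_cst.
  apply/funext => n; rewrite /series /= big_nat_recl//= expr0 mulr1.
  by rewrite big1 ?addr0// => i _; rewrite expr0n mulr0.
rewrite (_ : series _ =
    (fun n => (series (fun n => a n * z ^+ n) n.+1 - a 0%N) * z^-1 : R[i]^o)).
  apply: cvgM; last exact: cvg_cst.
  apply: cvgB; last exact: cvg_cst.
  by rewrite (cvg_shiftS (series (fun n => a n * z ^+ n : R[i]^o))); exact: af.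
apply/funext => n; rewrite /series /= big_nat_recl//= expr0 mulr1 addrAC subrr.
rewrite add0r mulr_suml; apply: eq_bigr => i _.
by rewrite exprSr mulrA mulfK.
Qed.

Lemma hardy_divX a (f : R[i] -> R[i]^o) : power_series_on_disk a f ->
  cvgn (series (fun n => Normc.normc (a n) ^+ 2)) ->
  hardy_disk (fun z => if z == 0 then a 1%N else (f z - a 0%N) / z).
Proof.
move=> af ca; exists (fun n => a n.+1); first exact: power_series_divX.
have -> : series (fun n => Normc.normc (a n.+1) ^+ 2) = (fun n =>
    series (fun n => Normc.normc (a n) ^+ 2) n.+1 - Normc.normc (a 0%N) ^+ 2).
  by apply/funext => n; rewrite /series /= big_nat_recl//= addrAC subrr add0r.
apply: is_cvgB; last exact: is_cvg_cst.
by apply/cvg_ex; case/cvg_ex: ca => l ca; exists l; rewrite cvg_shiftS.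
Qed.

Lemma radial_cvg t :
  (r%:C * expi t : R[i]^o) @[r --> (1 : R)^'-] --> (expi t : R[i]^o).
Proof.
rewrite -[X in _ --> X]mul1r; apply: cvgM; last exact: cvg_cst.
apply/cvgrPdist_le => e; rewrite ltcE /= => /andP[/eqP ei e0].
have -> : e = (complex.Re e)%:C by case: e ei {e0} => ? ? /= ->.
near=> r; rewrite -[1]/(1%:C) -rmorphB /= normE /= expr0n addr0 sqrtr_sqr lecR.
near: r; apply: (@cvg_at_left_filter _ _ id (1 : R) (1 : R)) => //.
by apply/nbhs_ballP; exists (complex.Re e) => //= x /ltW.
Unshelve. all: by end_near. Qed.

Lemma boundary_mul (f1 f2 : R[i] -> R[i]^o) t u v :
  radial_limit f1 t u -> radial_limit f2 t v ->
  radial_limit (fun z => f1 z * f2 z) t (u * v).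
Proof. exact: cvgM. Qed.

Lemma mean_boundary a (f : R[i] -> R[i]^o) g : power_series_on_disk a f ->
  cvgn (series (fun n => Normc.normc (a n) ^+ 2)) -> boundary_value f g ->
  mean (L2rep g) = a 0%N.
Proof.
move=> af ca fg; rewrite -[RHS]mul1r.
have m1 z : `|z| < 1 -> `|1 : R[i]| <= (1 : R)%:C by rewrite normr1.
apply: (mean_mul_hardy power_series1 m1 af ca (cmeasurable_L2rep g)).
apply: filterS fg => t; rewrite /radial_limit.
by under [X in _ -> X @ _ --> _]eq_fun do rewrite mul1r.
Qed.

(** The backward shift f |-> (f - f(0)) / z, written on boundary values: there
    1 / z is the conjugate of z and f(0) is the mean. *)
Definition backward_shift g : L2 R :=
  toL2 (fun t => zpow (- 1) t * (L2rep g t - mean (L2rep g))).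

Lemma sqint_backward_shift g :
  ((fun t => zpow (- 1) t * (L2rep g t - mean (L2rep g))) : R -> R[i]^o)
    \in sqintegrable.
Proof.
apply: (sqintMb (C := 1)); first exact: cmeasurable_zpow.
  by apply: aeW => t; rewrite sqnorm_zpow.
by apply: sqintD; [exact: L2repP|exact: sqint_cst].
Qed.

Lemma L2rep_backward_shift g : {ae mu, forall t,
  L2rep (backward_shift g) t = zpow (- 1) t * (L2rep g t - mean (L2rep g))}.
Proof. by apply: L2rep_toL2; exact: sqint_backward_shift. Qed.

Lemma sqint_zmul k g :
  ((fun t => zpow k t * L2rep g t) : R -> R[i]^o) \in sqintegrable.
Proof.
apply: (sqintMb (C := 1)); first exact: cmeasurable_zpow.
  by apply: aeW => t; rewrite sqnorm_zpow.
exact: L2repP.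
Qed.

Lemma boundary_zmul alpha h g : boundary_value (fun z => alpha z * h z) g ->
  {ae mu, forall t, radial_limit (fun z => alpha z * (z * h z)) t
    (zpow 1 t * L2rep g t)}.
Proof.
have -> : (fun z => alpha z * (z * h z)) = (fun z => z * (alpha z * h z)).
  by apply/funext => z; rewrite mulrCA.
apply: filterS => t ag; apply: (boundary_mul (f1 := id)) ag.
by rewrite zpow1; exact: radial_cvg.
Qed.

Lemma mul_H2_zmul alpha g : mul_H2 alpha g ->
  mul_H2 alpha (toL2 (fun t => zpow 1 t * L2rep g t)).
Proof.
move=> [h hh ag]; exists (fun z => z * h z); first exact: hardy_mulX.
by apply: filterS2 (boundary_zmul ag) (L2rep_toL2 (sqint_zmul 1 g)) => t ? ->.
Qed.

Lemma mean_mul_H2 alpha g : inner_function alpha -> mul_H2 alpha g ->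
  mean (fun t => zpow 1 t * L2rep g t) = 0.
Proof.
move=> [[a aa] [M aM] _] [h [b bh cb] ag]; rewrite -[RHS](mulr0 (a 0%N)).
apply: (mean_mul_hardy aa aM (power_series_mulX bh) (summable_mulX cb)).
  by apply: cmeasurableM; [exact: cmeasurable_zpow|exact: cmeasurable_L2rep].
exact: boundary_zmul.
Qed.

(** Let S g = (g - g(0)) / z. For k = alpha h, moving 1 / z to the other side
    gives <S g, k> = <g, z k> - g(0) <1, z k>. The first term vanishes because
    z k = alpha (z h) and g is orthogonal to alpha H2, the second because z k
    is the boundary value of a function vanishing at 0. *)
Lemma backward_shift_model_space alpha g : inner_function alpha ->
  model_space alpha g -> model_space alpha (backward_shift g).
Proof.
move=> ina [[f [a af ca] fg] gperp]; have m0 := mean_boundary af ca fg.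
split.
  exists (fun z => if z == 0 then a 1%N else (f z - a 0%N) / z).
    exact: hardy_divX.
  apply: filterS2 fg (L2rep_backward_shift g) => t ft ->;
    rewrite m0 /radial_limit.
  have L : (((f (r%:C * expi t) - a 0%N) / (r%:C * expi t)) : R[i]^o)
      @[r --> (1 : R)^'-] --> (zpow (- 1) t * (L2rep g t - a 0%N) : R[i]^o).
    rewrite mulrC zpowV zpow1; apply: cvgM.
      by apply: cvgB; [exact: ft|exact: cvg_cst].
    by apply: cvgV; [exact: expi_neq0|exact: radial_cvg].
  apply: cvg_trans L; apply: near_eq_cvg.
  near=> r; rewrite mulf_eq0 (negbTE (expi_neq0 t)) orbF.
  rewrite (_ : (r%:C == 0 :> R[i]) = false)//.
  by rewrite eq_complex /= eqxx andbT gt_eqF//; near: r; exact: nbhs_left_gt.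
move=> g' ag'; have zg := gperp _ (mul_H2_zmul ag').
rewrite (@inner_ae _ _ _ (fun t => zpow (- 1) t * (L2rep g t - mean (L2rep g)))
  (L2rep g')).
- have -> : (fun t => zpow (- 1) t * (L2rep g t - mean (L2rep g)) * (L2rep g'
    t)^*%C)
   = (fun t => L2rep g t * (zpow 1 t * L2rep g' t)^*%C +
       (- mean (L2rep g)) * (zpow 1 t * L2rep g' t)^*%C).
    apply/funext => t; rewrite conjcM zpowJ -mulrDl.
    by rewrite [zpow _ _ * _]mulrC mulrA.
  have J := sqintJ (sqint_zmul 1 g').
  rewrite meanD; last 2 first.
  + by apply: sqintM => //; exact: L2repP.
  + by apply: cintegrableZ; exact: sqint_cintegrable.
  rewrite meanZ; last exact: sqint_cintegrable.
  rewrite meanJ; last by apply: sqint_cintegrable; exact: sqint_zmul.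
  rewrite (mean_mul_H2 ina ag') conjc0 mulr0 addr0 -zg.
  rewrite (@inner_ae _ _ _ (L2rep g) (fun t => zpow 1 t * L2rep g' t))//.
  + exact: cmeasurable_L2rep.
  + by apply: cmeasurableM; [exact: cmeasurable_zpow|exact: cmeasurable_L2rep].
  + exact: aeW.
  + by apply: L2rep_toL2; exact: sqint_zmul.
- by have /sqintP[] := sqint_backward_shift g.
- exact: cmeasurable_L2rep.
- exact: L2rep_backward_shift.
- exact: aeW.
Unshelve. all: by end_near. Qed.

End BackwardShift.

(** * Linear algebra and polynomials *)

Lemma size_det_le (K : comNzRingType) n (A : 'M[{poly K}]_n) :
  (forall i j, (size (A i j) <= 2)%N) -> (size (\det A) <= n.+1)%N.
Proof.
move=> sA; apply: leq_trans (size_sum _ _ _) _; apply/bigmax_leqP => s _.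
rewrite -signr_odd; case: odd; rewrite ?expr0 ?expr1 ?mul1r ?mulN1r ?size_polyN;
  (apply: leq_trans (size_poly_prod_leq _ _) _;
    rewrite cardT size_enum_ord leq_subLR;
   apply: leq_trans (_ : (\sum_(i < n) 2).+1 <= _)%N;
   [by rewrite ltnS leq_sum|by rewrite sum_nat_const card_ord muln2 -addnn
     addnS]).
Qed.

(** Cofactors are minors of order n of a matrix of polynomials of degree at
    most 1. *)
Lemma size_adj_char_poly_mx (K : comNzRingType) n (A : 'M[K]_n.+1) i j :
  (size (\adj (char_poly_mx A) i j) <= n.+1)%N.
Proof.
rewrite mxE /cofactor -signr_odd.
have H : (size (\det (row' j (col' i (char_poly_mx A)))) <= n.+1)%N.
  apply: size_det_le => k l; rewrite !mxE.
  apply: leq_trans (size_polyD _ _) _; rewrite size_polyN geq_max.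
  rewrite (leq_trans (size_polyC_leq1 _))// andbT.
  by case: eqP => _; rewrite ?mulr1n ?mulr0n ?size_polyX ?size_poly0.
by case: odd; rewrite ?expr0 ?expr1 ?mul1r ?mulN1r ?size_polyN.
Qed.

Section Span.
Variables (K : fieldType) (V : lmodType K).

Definition lfree n (e : 'I_n -> V) :=
  forall c : 'I_n -> K, \sum_(i < n) c i *: e i = 0 -> forall i, c i = 0.

Definition lspan n (e : 'I_n -> V) : set V :=
  [set v | exists c : 'I_n -> K, v = \sum_(i < n) c i *: e i].

Lemma mulmx_lincomb m n (e : 'I_n -> V) (P : 'M[K]_(m, n)) (c : 'I_m -> K) :
  \sum_(i < m) c i *: (\sum_(j < n) P i j *: e j) =
  \sum_(j < n) ((\row_i c i) *m P) 0 j *: e j.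
Proof.
under eq_bigr do rewrite scaler_sumr.
rewrite exchange_big; apply: eq_bigr => j _; rewrite mxE scaler_suml.
by apply: eq_bigr => i _; rewrite scalerA mxE.
Qed.

Lemma basis_change n (e : 'I_n -> V) (P : 'M[K]_n) : P \in unitmx -> lfree e ->
  lfree (fun i => \sum_(j < n) P i j *: e j) /\
  lspan (fun i => \sum_(j < n) P i j *: e j) = lspan e.
Proof.
move=> Pu fe; split.
  move=> c; rewrite mulmx_lincomb => /fe H i.
  have : \row_i c i = 0.
    rewrite -[LHS](mulmxK Pu) (_ : _ *m P = 0) ?mul0mx//.
    by apply/rowP => j; rewrite H mxE.
  by move/rowP/(_ i); rewrite !mxE.
apply/seteqP; split => v [c ->].
  by rewrite mulmx_lincomb; eexists.
exists (fun i => ((\row_i c i) *m invmx P) 0 i); rewrite mulmx_lincomb.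
apply: eq_bigr => j _; congr (_ *: _).
have -> : \row_i ((\row_k c k) *m invmx P) 0 i = (\row_k c k) *m invmx P.
  by apply/rowP => i; rewrite [LHS]mxE.
by rewrite mulmxKV// mxE.
Qed.
End Span.

Section RootsOffCircle.
Context {R : realType}.
Implicit Types (F G : R -> R[i]) (z w : R[i]) (t : R) (f g : L2 R).
Local Notation mu := (@arclength R).

(** Over the complex numbers p is a product of linear factors, and the modulus
    of w - z lies between |1 - |z|| and 1 + |z| when |w| = 1. *)
Lemma root_free_bound (p : {poly R[i]}) : p != 0 ->
  (forall z, root p z -> sqnorm z != 1) ->
  exists c C : R, 0 < c /\ forall w, sqnorm w = 1 -> c <= sqnorm p.[w] <= C.
Proof.
move=> p0 pr; have [s ps] := closed_field_poly_normal p.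
have rs z : z \in s -> sqnorm z != 1.
  move=> zs; apply: pr; rewrite ps rootZ ?lead_coef_eq0//.
  by rewrite root_prod_XsubC.
have [c [C [c0 H]]] : exists c C : R, 0 < c /\ forall w, sqnorm w = 1 ->
    c <= sqnorm (\prod_(z <- s) ('X - z%:P)).[w] <= C.
  elim: s rs {ps} => [|z s IH] rs.
    exists 1, 1; split=> // w _; rewrite big_nil hornerC.
    by rewrite /sqnorm /= expr1n expr0n /= addr0 lexx.
  have [|c [C [c0 H]]] := IH; first by move=> y ys; apply: rs;
    rewrite in_cons ys orbT.
  pose n := Normc.normc z.
  have n1 : n != 1.
    by apply: contra (rs z (mem_head _ _)) => /eqP n1;
      rewrite sqnorm_normc -/n n1 expr1n.
  exists ((1 - n) ^+ 2 * c), ((1 + n) ^+ 2 * C); split.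
    by rewrite mulr_gt0// exprn_even_gt0//= subr_eq0 eq_sym.
  move=> w w1; rewrite big_cons hornerM hornerXsubC sqnormM.
  have nw : Normc.normc w = 1.
    apply/eqP; rewrite -(@eqrXn2 _ 2)// ?normc_ge0// -sqnorm_normc w1 expr1n//.
  have /andP[H1 H2] := H w w1.
  have n0 : 0 <= n by exact: normc_ge0.
  have d0 := normc_ge0 (w - z).
  have t1 : Normc.normc (w - z) <= 1 + n.
    by rewrite -nw; apply: le_trans (le_normcD _ _) _; rewrite normcN.
  have t2 : 1 <= Normc.normc (w - z) + n.
    by rewrite -nw -[w in leLHS](subrK z); exact: le_normcD.
  have t3 : n <= Normc.normc (w - z) + 1.
    have := le_normcD w (- (w - z)); rewrite normcN (subKr w z) nw addrC.
    exact.
  apply/andP; split; apply: ler_pM => //; rewrite ?sqr_ge0 ?sqnorm_ge0 ?(ltW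
    c0)//.
  - rewrite sqnorm_normc; nra.
  - rewrite sqnorm_normc; nra.
exists (sqnorm (lead_coef p) * c), (sqnorm (lead_coef p) * C); split.
  by rewrite mulr_gt0// lt_neqAle sqnorm_ge0 andbT eq_sym sqnorm_eq0
    lead_coef_eq0.
move=> w /H/andP[H1 H2]; rewrite ps hornerZ sqnormM lead_coefZ.
by rewrite (monicP (monic_prod_XsubC _ _ _)) mulr1 !ler_wpM2l ?sqnorm_ge0.
Qed.

End RootsOffCircle.

(** * A rational basis of the model space *)

Section RationalBasis.
Context {R : realType}.
Implicit Types (F G : R -> R[i]) (z w : R[i]) (t : R) (f g : L2 R).
Local Notation mu := (@arclength R).

Lemma ae_arclength_itv : {ae mu, forall t, 0 <= t <= 2 * pi}.
Proof.
exists (~` `[0, 2 * pi]%classic); split.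
- exact: measurableC.
- rewrite /arclength /= /uniform_prob.
  apply: integral0_eq => t; rewrite /= in_itv /= => /negP/negbTE h.
  by rewrite /uniform_pdf h.
- by move=> t /= nt; rewrite in_itv.
Qed.

Lemma ae_arclength_neq (t0 : R) : {ae mu, forall t, t != t0}.
Proof.
exists [set t0]; split; first exact: measurable_set1.
- apply: ((null_content_dominatesP _ _).1 (dominates_uniform_prob (@pi2_gt0
    R))).
    exact: measurable_set1.
  exact: lebesgue_measure_set1.
- by move=> t /= /negP; rewrite negbK => /eqP.
Qed.

(** A point of the circle has at most one angle in each half period, by
    injectivity of the cosine on [0, pi]. *)
Lemma ae_expi_neq w : {ae mu, forall t, expi t != w}.
Proof.
have one_point (A : set R) :
    (forall s t, A s -> A t -> expi s = w -> expi t = w -> s = t) ->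
    {ae mu, forall t, A t -> expi t != w}.
  move=> inj; have [[t0 [At0 t0w]]|no] := pselect (exists t0,
    A t0 /\ expi t0 = w).
    apply: filterS (ae_arclength_neq t0) => t tt0 At; apply: contra tt0 =>
      /eqP tw.
    by apply/eqP; exact: inj.
  by apply: aeW => t At; apply/eqP => tw; apply: no; exists t.
have H1 : {ae mu, forall t, `[0, pi]%classic t -> expi t != w}.
  apply: one_point => s t As At <- [cs _]; apply/esym; apply: cos_inj => //.
have H2 : {ae mu, forall t, `[pi, 2 * pi]%classic t -> expi t != w}.
  apply: one_point => s t; rewrite /= !in_itv /= =>
    /andP[s1 s2] /andP[t1 t2] <- [cs _].
  apply/esym/oppr_inj/(addrI (2 * pi)); apply: cos_inj.
  - by rewrite in_itv /=; apply/andP; split; lra.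
  - by rewrite in_itv /=; apply/andP; split; lra.
  - have pE : 2 * pi = pi *+ 2 :> R by rewrite mulrC mulr_natr.
    by rewrite pE [LHS]cosD [RHS]cosD !cosN !sinN cos2pi sin2pi !mul1r !mul0r
      cs.
apply: filterS3 ae_arclength_itv H1 H2 => t /andP[t0 t2] h1 h2.
have [tp|tp] := leP t pi; first by apply: h1; rewrite /= in_itv /= t0.
by apply: h2; rewrite /= in_itv /= t2 ltW.
Qed.

Lemma ae_forall_fin (I : finType) (P : I -> R -> Prop) :
  (forall i, {ae mu, forall t, P i t}) -> {ae mu, forall t, forall i, P i t}.
Proof.
by move=> H; apply: (@filter_forall (measurableTypeR R) _ (fun i =>
  [set t | P i t])).
Qed.

Lemma mean_lincomb n (c : 'I_n -> R[i]) (f : 'I_n -> L2 R) :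
  mean (L2rep (\sum_(i < n) c i *: f i)) =
  \sum_(i < n) c i * mean (L2rep (f i)).
Proof.
have ci i : cintegrable (fun t => c i * L2rep (f i) t).
  by apply: cintegrableZ; apply: sqint_cintegrable; exact: L2repP.
rewrite (mean_ae (G := fun t => \sum_(i < n) c i * L2rep (f i) t)).
- rewrite mean_sum//; apply: eq_bigr => i _.
  by rewrite meanZ//; apply: sqint_cintegrable; exact: L2repP.
- exact: cmeasurable_L2rep.
- by apply: cmeasurable_sum => i; apply: cmeasurableM;
    [exact: cmeasurable_cst|exact: cmeasurable_L2rep].
- exact: L2rep_lincomb.
Qed.

(** The variance identity; it makes the backward shift strictly contractive
    on functions of nonzero mean. *)
Lemma sqL2norm_center f :
  \int[mu]_t sqnorm (L2rep f t - mean (L2rep f)) =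
  sqL2norm f - sqnorm (mean (L2rep f)).
Proof.
set m := mean _; apply: complexI.
have fi := L2repP f; have mi := sqint_cst (- m).
have ci := sqint_cintegrable fi.
have mF : cmeasurable (fun t => L2rep f t - m).
  by apply: cmeasurableD; [exact: cmeasurable_L2rep|exact: cmeasurable_cst].
rewrite -mean_sqnorm// rmorphB /= -inner_self innerE.
have -> : (fun t => (L2rep f t - m) * (L2rep f t - m)^*%C) =
  (fun t => L2rep f t * (L2rep f t)^*%C + ((- m^*%C) * L2rep f t +
    (- m) * (L2rep f t - m)^*%C)).
  apply/funext => t; rewrite !conjcD (_ : (- m)^*%C = - m^*%C); first by ring.
  by case: m {mi mF} => x y.
have ci2 : cintegrable (fun t => (L2rep f t - m)^*%C).
  by apply: sqint_cintegrable; apply: sqintJ; exact: sqintD.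
rewrite meanD; last 2 first.
- exact: cintegrable_inner.
- by apply: cintegrableD; apply: cintegrableZ.
rewrite meanD; try exact: cintegrableZ.
rewrite !meanZ// meanJ; last by apply: cintegrableD => //;
  exact: sqint_cintegrable.
rewrite meanD//; last exact: sqint_cintegrable.
by rewrite mean_cst -/m subrr conjc0 mulr0 addr0 sqnormE mulNr [m^*%C * m]mulrC.
Qed.

(** If S g = z g with |z| = 1, then S preserves the norm of g, so the variance
    identity forces the mean of g to vanish; now S g is g divided by the
    coordinate function, and g vanishes wherever that function differs
    from 1 / z, that is almost everywhere. *)
Lemma shift_eigenvalue_circle n (e : 'I_n -> L2 R) (M : 'M[R[i]]_n) z :
  lfree e -> (forall i, backward_shift (e i) = \sum_(j < n) M i j *: e j) ->
  root (char_poly M) z -> sqnorm z != 1.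
Proof.
move=> fe eM; rewrite -eigenvalue_root_char => /eigenvalueP[v vM v0].
apply/eqP => z1.
pose g := \sum_(i < n) v 0 i *: e i.
have shift_eq : {ae mu, forall t, zpow (- 1) t * (L2rep g t - mean (L2rep g)) =
  z * L2rep g t}.
  have H : {ae mu, forall t, forall i,
      zpow (- 1) t * (L2rep (e i) t - mean (L2rep (e i))) = \sum_(j < n) M i j
        * L2rep (e j) t}.
    apply: ae_forall_fin => i.
    apply: filterS2 (L2rep_backward_shift (e i)) (L2rep_lincomb (M i) e) =>
      t <- <-.
    by rewrite eM.
  apply: filterS2 H (L2rep_lincomb (v 0) e) => t H ->.
  rewrite mean_lincomb -sumrB mulr_sumr.
  under eq_bigr => i _ do rewrite -mulrBr mulrCA H mulr_sumr.
  rewrite exchange_big mulr_sumr /=; apply: eq_bigr => j _.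
  transitivity ((v *m M) 0 j * L2rep (e j) t).
    by rewrite mxE mulr_suml; apply: eq_bigr => i _; rewrite mulrA.
  by rewrite vM mxE mulrA.
have m0 : mean (L2rep g) = 0.
  apply/eqP; rewrite -sqnorm_eq0; apply/eqP.
  have := sqL2norm_center g; set m := mean _ => E.
  suff E2 : \int[mu]_t sqnorm (L2rep g t - m) = sqL2norm g.
    by move: E; rewrite E2 => /eqP; rewrite eq_sym subr_eq addrC -subr_eq subrr
      => /eqP <-.
  congr fine; apply: ae_eq_integral => //.
  - by apply: cmeasurable_sqn; apply: cmeasurableD;
      [exact: cmeasurable_L2rep|exact: cmeasurable_cst].
  - by apply: cmeasurable_sqn; exact: cmeasurable_L2rep.
  - apply: filterS shift_eq => t shift_eq _; congr EFin.
    by have := congr1 sqnorm shift_eq; rewrite !sqnormM sqnorm_zpow z1 !mul1r.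
have g0 : g = 0.
  apply: L2_ext; apply: filterS3 shift_eq (ae_expi_neq z^-1) L2rep0 =>
    t shift_eq tz ->.
  move: shift_eq; rewrite m0 subr0 => /eqP; rewrite -subr_eq0 -mulrBl mulf_eq0.
  case/orP => [|/eqP//]; rewrite subr_eq0 zpowV zpow1 => /eqP zE.
  by move: tz; rewrite -zE invrK eqxx.
move/eqP: v0; apply; apply/rowP => i; rewrite mxE.
exact: (fe (v 0) g0).
Qed.

(** Let M be the matrix of the backward shift in the basis e. Then the vector e
    satisfies (w - M) e = w a, where w = 1 / z and a is the vector of means.
    Multiplying by the adjugate shows that chi(w) e_i is a combination of
    w, ..., w^(n+1), chi being the characteristic polynomial. As chi does not
    vanish on the circle, the square matrix B of these combinations is
    invertible, and its inverse changes e into the basis w^(i+1) / chi(w). *)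
Lemma rational_basis n (e : 'I_n.+1 -> L2 R) :
  lfree e -> (forall i, lspan e (backward_shift (e i))) ->
  exists (D : R -> R[i]) (f : 'I_n.+1 -> L2 R) (c C : R),
    [/\ cmeasurable D, 0 < c, (forall t, c <= sqnorm (D t) <= C) &
     (forall i, {ae mu, forall t, D t * L2rep (f i) t = zpow (- (i.+1)%:Z) t})]
       /\
    lfree f /\ lspan f = lspan e.
Proof.
move=> fe se; have [Mf HM] := choice se.
have [M eM] : exists M : 'M[R[i]]_n.+1, forall i,
    backward_shift (e i) = \sum_(j < n.+1) M i j *: e j.
  exists (\matrix_(i, j) Mf i j) => i.
  by rewrite HM; apply: eq_bigr => j _; rewrite mxE.
pose chi := char_poly M.
have [c [C [c0 cC]]] : exists c C : R, 0 < c /\ forall w, sqnorm w = 1 ->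
  c <= sqnorm chi.[w] <= C.
  apply: root_free_bound; first by rewrite monic_neq0// char_poly_monic.
  by move=> z; exact: shift_eigenvalue_circle fe eM.
pose q i : {poly R[i]} := \sum_(j < n.+1)
  \adj (char_poly_mx M) i j * (mean (L2rep (e j)))%:P.
have sq i : (size (q i) <= n.+1)%N.
  apply: leq_trans (size_sum _ _ _) _; apply/bigmax_leqP => j _.
  apply: leq_trans (size_polyMleq _ _) _.
  have := size_adj_char_poly_mx M i j; have := size_polyC_leq1 (mean (L2rep (e
    j))).
  by case: (size _) => [|[|k]]//; rewrite ?addn0 ?addn1 //= => _ h;
    apply: leq_trans (leq_pred _) h.
pose D t := chi.[zpow (- 1) t].
pose B : 'M[R[i]]_n.+1 := \matrix_(i, l) (q i)`_l.
have wX t (l : nat) : zpow (- 1) t * zpow (- 1) t ^+ l = zpow (- (l.+1)%:Z) t.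
  by rewrite -exprS !zpowV zpow1 exprVn zpowX.
have De : {ae mu, forall t, forall i,
    D t * L2rep (e i) t = \sum_(l < n.+1) B i l * zpow (- (l.+1)%:Z) t}.
  have H : {ae mu, forall t, forall i,
      zpow (- 1) t * (L2rep (e i) t - mean (L2rep (e i))) =
      \sum_(j < n.+1) M i j * L2rep (e j) t}.
    apply: ae_forall_fin => i.
    apply: filterS2 (L2rep_backward_shift (e i)) (L2rep_lincomb (M i) e) =>
      t <- <-.
    by rewrite eM.
  apply: filterS H => t H i; set w := zpow (- 1) t.
  pose E := \col_j L2rep (e j) t; pose a := \col_j mean (L2rep (e j)).
  have E1 : map_mx (horner_eval w) (char_poly_mx M) *m E = w *: a.
    apply/colP => k; rewrite !mxE.
    under eq_bigr => j _ do rewrite !mxE horner_evalE hornerD hornerN hornerC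
      hornerMn hornerX mulrBl.
    rewrite sumrB (bigD1 k)//= eqxx mulr1n big1 ?addr0; last first.
      by move=> j jk; rewrite eq_sym (negbTE jk) mulr0n mul0r.
    by rewrite -H mulrBr opprB addrCA subrr addr0.
  have E2 := congr1 (mulmx (map_mx (horner_eval w) (\adj (char_poly_mx M)))) E1.
  move: E2; rewrite mulmxA -map_mxM mul_adj_mx map_scalar_mx mul_scalar_mx.
  move/colP/(_ i); rewrite !mxE => E2; apply: etrans E2 _.
  under eq_bigr => j _ do rewrite !mxE horner_evalE mulrCA.
  rewrite -mulr_sumr.
  transitivity (w * (q i).[w]).
    rewrite horner_sum; congr (_ * _); apply: eq_bigr => j _.
    by rewrite [RHS]hornerM hornerC [in RHS]mxE.
  rewrite (horner_coef_wide _ (sq i)) mulr_sumr; apply: eq_bigr => l _.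
  by rewrite mulrCA wX mxE.
have D0 t : D t != 0.
  by rewrite -sqnorm_eq0 gt_eqF// (lt_le_trans c0)//;
    case/andP: (cC _ (sqnorm_zpow (- 1) t)).
have Bu : B \in unitmx.
  rewrite -row_free_unit; apply: inj_row_free => v vB.
  apply/rowP => i; rewrite mxE; apply: (fe (v 0)).
  apply: L2_ext; apply: filterS3 De (L2rep_lincomb (v 0) e) L2rep0 => t De ->
    ->.
  apply: (mulfI (D0 t)); rewrite mulr0 mulr_sumr.
  under eq_bigr => j _ do rewrite mulrCA De mulr_sumr.
  rewrite exchange_big big1// => l _.
  transitivity ((v *m B) 0 l * zpow (- (l.+1)%:Z) t).
    by rewrite mxE mulr_suml; apply: eq_bigr => j _; rewrite mulrA.
  by rewrite vB mxE mul0r.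
exists D, (fun i => \sum_(j < n.+1) (invmx B) i j *: e j), c, C; split;
  last first.
  by apply: basis_change => //; rewrite unitmx_inv.
split => //.
- rewrite /D; under eq_fun do rewrite horner_coef.
  apply: cmeasurable_sum => i; apply: cmeasurableM;
    first exact: cmeasurable_cst.
  by apply: cmeasurable_exp; exact: cmeasurable_zpow.
- by move=> t; apply: cC; exact: sqnorm_zpow.
- move=> i; apply: filterS2 De (L2rep_lincomb (invmx B i) e) => t De ->.
  rewrite mulr_sumr; under eq_bigr => j _ do rewrite mulrCA De mulr_sumr.
  rewrite exchange_big /=.
  transitivity (\sum_(l < n.+1) (invmx B *m B) i l * zpow (- (l.+1)%:Z) t).
    by apply: eq_bigr => l _; rewrite mxE mulr_suml; apply: eq_bigr => j _;
      rewrite mulrA.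
  rewrite mulVmx// (bigD1 i)//= mxE eqxx mul1r big1 ?addr0// => l li.
  by rewrite mxE eq_sym (negbTE li) mul0r.
Qed.

End RationalBasis.

(** * Orthogonal projection onto a finite-dimensional subspace *)

Section Projection.
Context {R : realType}.
Implicit Types (f g h x y : L2 R).

Lemma lspan_lin (K : fieldType) (V : lmodType K) n (e : 'I_n -> V) a u v :
  lspan e u -> lspan e v -> lspan e (a *: u + v).
Proof.
move=> [c ->] [d ->]; exists (fun i => a * c i + d i).
rewrite scaler_sumr -big_split; apply: eq_bigr => i _.
by rewrite scalerDl scalerA.
Qed.

Lemma lspan_mem (K : fieldType) (V : lmodType K) n (e : 'I_n -> V) i :
  lspan e (e i).
Proof.
exists (fun j => (j == i)%:R); rewrite (bigD1 i)//= eqxx scale1r big1 ?addr0//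
  => j.
by move=> /negbTE ->; rewrite scale0r.
Qed.

Lemma lspanB (K : fieldType) (V : lmodType K) n (e : 'I_n -> V) u v :
  lspan e u -> lspan e v -> lspan e (u - v).
Proof. by move=> eu ev; rewrite addrC -scaleN1r; exact: lspan_lin. Qed.

Definition is_projection (S : set (L2 R)) h x :=
  S x /\ forall y, S y -> inner_product (h - x) y = 0.

(** The coefficients solve a linear system whose matrix, the Gram matrix of the
    basis, is invertible because the inner product is definite. *)
Lemma is_projection_exists n (e : 'I_n -> L2 R) h : lfree e ->
  exists x, is_projection (lspan e) h x.
Proof.
move=> fe; pose G := \matrix_(i, j) inner_product (e i) (e j).
have Gu : G \in unitmx.
  rewrite -row_free_unit; apply: inj_row_free => v vG.
  apply/rowP => i; rewrite mxE; apply: (fe (v 0)); apply: sqL2norm_eq0;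
    apply: complexI.
  rewrite -inner_self inner_sumr big1// => j _.
  have E : \sum_(k < n) v 0 k * inner_product (e k) (e j) = (v *m G) 0 j.
    by rewrite [RHS]mxE; apply: eq_bigr => k _; rewrite [G _ _]mxE.
  by rewrite inner_suml E vG mxE mulr0.
pose b := \row_j inner_product h (e j); pose c := b *m invmx G.
exists (\sum_(i < n) c 0 i *: e i); split; first by exists (c 0).
move=> _ [d ->]; rewrite inner_sumr big1// => j _.
have E : \sum_(k < n) c 0 k * inner_product (e k) (e j) = (c *m G) 0 j.
  by rewrite [RHS]mxE; apply: eq_bigr => k _; rewrite [G _ _]mxE.
by rewrite innerBl inner_suml E mulmxKV// mxE subrr mulr0.
Qed.

Lemma is_projection_unique n (e : 'I_n -> L2 R) h x y :
  is_projection (lspan e) h x -> is_projection (lspan e) h y -> x = y.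
Proof.
move=> [Sx px] [Sy py]; apply/eqP; rewrite -subr_eq0; apply/eqP.
apply: sqL2norm_eq0; apply: complexI; rewrite -inner_self.
have Sxy := lspanB Sx Sy.
have -> : inner_product (x - y) (x - y) =
    inner_product (h - y) (x - y) - inner_product (h - x) (x - y).
  by rewrite -innerBl opprB [h - y + _]addrC addrA subrK.
by rewrite px// py// subrr.
Qed.

Lemma pythagoras x y : inner_product x y = 0 ->
  sqL2norm (x + y) = sqL2norm x + sqL2norm y.
Proof.
move=> xy; apply: complexI; rewrite [RHS]rmorphD /= -!inner_self.
by rewrite innerDl !innerDr (innerC x y) xy conjc0 addr0 add0r.
Qed.

Variables (n : nat) (e : 'I_n -> L2 R) (fe : lfree e).
Let proj := orthogonal_projection (lspan e).

Lemma projP h : is_projection (lspan e) h (proj h).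
Proof. by have := is_projection_exists h fe; exact: xgetPex. Qed.

Lemma proj_unique h x : is_projection (lspan e) h x -> proj h = x.
Proof. exact: is_projection_unique (projP h). Qed.

Lemma inner_proj h i : inner_product (proj h) (e i) = inner_product h (e i).
Proof.
have [_ /(_ _ (lspan_mem e i))/eqP] := projP h.
by rewrite innerBl subr_eq0 => /eqP ->.
Qed.

Lemma proj_eq h h' :
  (forall i, inner_product h (e i) = inner_product h' (e i)) ->
  proj h = proj h'.
Proof.
move=> hh'; apply: proj_unique; split; first by have [] := projP h'.
move=> _ [c ->]; rewrite inner_sumr big1// => i _.
by rewrite innerBl inner_proj hh' subrr mulr0.
Qed.

Lemma proj_lin a h h' : proj (a *: h + h') = a *: proj h + proj h'.
Proof.
have [Ph _] := projP h; have [Ph' _] := projP h'.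
apply: proj_unique; split; first exact: lspan_lin.
move=> _ [c ->]; rewrite inner_sumr big1// => i _.
by rewrite innerBl !innerDl !innerZl !inner_proj subrr mulr0.
Qed.

Lemma proj0 : proj 0 = 0.
Proof.
apply: proj_unique; split => [|y _]; last by rewrite subrr inner0l.
by exists (fun=> 0); rewrite big1// => i _; rewrite scale0r.
Qed.

Lemma sqL2norm_proj h : sqL2norm (proj h) <= sqL2norm h.
Proof.
have [Ph Oh] := projP h.
have E := pythagoras (Oh _ Ph); rewrite subrK in E.
by rewrite E lerDr sqL2norm_ge0.
Qed.

End Projection.

(** * Multiplication operators and Toeplitz matrices *)

Section Multiplication.
Context {R : realType}.
Implicit Types (f g h x y phi : L2 R).
Local Notation mu := (@arclength R).

Definition L2bounded x :=
  exists C : R, {ae mu, forall t, sqnorm (L2rep x t) <= C}.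

(** Only meaningful when the pointwise product is square integrable, for example
    for a bounded second factor. *)
Definition mulL2 phi x : L2 R := toL2 (fun t => L2rep phi t * L2rep x t).

Lemma sqint_mulL2 phi x : L2bounded x ->
  ((fun t => L2rep phi t * L2rep x t) : R -> R[i]^o) \in sqintegrable.
Proof.
move=> [C xC]; under eq_fun do rewrite mulrC.
exact: sqintMb (cmeasurable_L2rep x) xC (L2repP phi).
Qed.

Lemma L2rep_mulL2 phi x : L2bounded x ->
  {ae mu, forall t, L2rep (mulL2 phi x) t = L2rep phi t * L2rep x t}.
Proof. by move=> xb; apply: L2rep_toL2; exact: sqint_mulL2. Qed.

Lemma L2bounded_lin a x y : L2bounded x -> L2bounded y ->
  L2bounded (a *: x + y).
Proof.
move=> [C xC] [C' yC]; exists (2 * (sqnorm a * C + C')).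
apply: filterS2 (filterI xC yC) (filterI (L2repD (a *: x) y) (L2repZ a x)).
move=> t [h1 h2] [-> ->].
apply: le_trans (sqnormD_le _ _) _; rewrite ler_pM2l// lerD// sqnormM.
by rewrite ler_wpM2l ?sqnorm_ge0.
Qed.

Lemma L2bounded0 : L2bounded 0.
Proof.
by exists 0; apply: filterS L2rep0 => t ->; rewrite /sqnorm /= expr0n /= addr0.
Qed.

Lemma L2bounded_sum n (c : 'I_n -> R[i]) (f : 'I_n -> L2 R) :
  (forall i, L2bounded (f i)) -> L2bounded (\sum_(i < n) c i *: f i).
Proof.
move=> fb; elim/big_rec: _ => [|i x _ IH]; first exact: L2bounded0.
exact: L2bounded_lin.
Qed.

Lemma mulL2_linr phi a x y : L2bounded x -> L2bounded y ->
  mulL2 phi (a *: x + y) = a *: mulL2 phi x + mulL2 phi y.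
Proof.
move=> xb yb; apply: L2_ext.
apply: filterS3 (L2rep_mulL2 phi (L2bounded_lin a xb yb))
  (filterI (L2rep_mulL2 phi xb) (L2rep_mulL2 phi yb))
  (filterI (filterI (L2repD (a *: x) y) (L2repZ a x))
    (filterI (L2repD (a *: mulL2 phi x) (mulL2 phi y)) (L2repZ a (mulL2 phi
      x)))).
move=> t -> [e1 e2] [[-> ->] [-> ->]]; rewrite e1 e2; ring.
Qed.

Lemma mulL2_linl phi psi a x : L2bounded x ->
  mulL2 (a *: phi + psi) x = a *: mulL2 phi x + mulL2 psi x.
Proof.
move=> xb; apply: L2_ext.
apply: filterS3 (L2rep_mulL2 (a *: phi + psi) xb)
  (filterI (L2rep_mulL2 phi xb) (L2rep_mulL2 psi xb))
  (filterI (filterI (L2repD (a *: phi) psi) (L2repZ a phi))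
    (filterI (L2repD (a *: mulL2 phi x) (mulL2 psi x)) (L2repZ a (mulL2 phi
      x)))).
move=> t -> [e1 e2] [[-> ->] [-> ->]]; rewrite e1 e2; ring.
Qed.

Lemma mulL20l x : mulL2 0 x = 0.
Proof.
apply: toL2_eq; last by apply: filterS L2rep0 => t E; rewrite E mul0r.
by apply: (sqintMb (C := 0)); [exact: cmeasurable_L2rep| |exact: L2repP];
  apply: filterS L2rep0 => t ->; rewrite /sqnorm /= expr0n /= addr0.
Qed.

Lemma mulL20r phi : mulL2 phi 0 = 0.
Proof.
apply: toL2_eq; last by apply: filterS L2rep0 => t E; rewrite E mulr0.
exact: sqint_mulL2 L2bounded0.
Qed.

Lemma inner_mulL2 phi x y : L2bounded x ->
  inner_product (mulL2 phi x) y =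
  mean (fun t => L2rep phi t * L2rep x t * (L2rep y t)^*%C).
Proof.
move=> xb; apply: inner_ae; last exact: aeW.
- by apply: cmeasurableM; exact: cmeasurable_L2rep.
- exact: cmeasurable_L2rep.
- exact: L2rep_mulL2.
Qed.

Lemma sqL2norm_mulL2 phi x C : 0 <= C ->
  {ae mu, forall t, sqnorm (L2rep phi t) <= C} -> L2bounded x ->
  sqL2norm (mulL2 phi x) <= C * sqL2norm x.
Proof.
move=> C0 pC xb; have [mx Ix] := (sqintP _).1 (L2repP x).
have [mp Ip] := (sqintP _).1 (L2repP (mulL2 phi x)).
rewrite -lee_fin /sqL2norm /Rintegral EFinM !fineK ?ge0_fin_numE//;
  last 2 first.
- by apply: integral_ge0 => t _; rewrite lee_fin sqnorm_ge0.
- by apply: integral_ge0 => t _; rewrite lee_fin sqnorm_ge0.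
rewrite -ge0_integralZl//; last 2 first.
- exact: cmeasurable_sqn.
- by move=> t _; rewrite lee_fin sqnorm_ge0.
apply: ae_ge0_le_integral => //.
- by move=> t _; rewrite lee_fin sqnorm_ge0.
- exact: cmeasurable_sqn.
- by move=> t _; rewrite -EFinM lee_fin mulr_ge0 ?sqnorm_ge0.
- by apply: emeasurable_funM => //; exact: cmeasurable_sqn.
- apply: filterS2 pC (L2rep_mulL2 phi xb) => t pC -> _.
  by rewrite -EFinM lee_fin sqnormM ler_wpM2r ?sqnorm_ge0.
Qed.

End Multiplication.

(** The backward shift acts on the model space, so its characteristic polynomial
    provides the common denominator D. *)
Lemma model_space_basis (R : realType) (alpha : R[i] -> R[i]^o) m :
  inner_function alpha -> has_dimension (model_space alpha) m.+1 ->
  exists (D : R -> R[i]) (f : 'I_m.+1 -> L2 R) (c C : R),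
    [/\ cmeasurable D, 0 < c, (forall t, c <= sqnorm (D t) <= C) &
     (forall i, {ae arclength, forall t,
        D t * L2rep (f i) t = zpow (- (i.+1)%:Z) t})] /\
    lfree f /\ model_space alpha = lspan f.
Proof.
move=> ina [e [fe Se]]; have Se' : model_space alpha = lspan e by [].
have be i : lspan e (backward_shift (e i)).
  by rewrite -Se'; apply: backward_shift_model_space => //; rewrite Se';
    exact: lspan_mem.
have [D [f [c [C [H [ff sf]]]]]] := rational_basis fe be.
by exists D, f, c, C; split=> //; split=> //; rewrite Se' sf.
Qed.

Section Operators.
Context {R : realType}.
Implicit Types (x y phi psi : L2 R) (t : R).
Local Notation mu := (@arclength R).
Variables (alpha beta : R[i] -> R[i]^o) (m n : nat).
Variables (D1 D2 : R -> R[i]) (f : 'I_m.+1 -> L2 R) (g : 'I_n.+1 -> L2 R).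
Variables (c1 C1 c2 C2 : R).
Hypotheses (mD1 : cmeasurable D1) (c1_gt0 : 0 < c1)
  (D1b : forall t, c1 <= sqnorm (D1 t) <= C1).
Hypothesis D1f : forall i, {ae mu, forall t,
  D1 t * L2rep (f i) t = zpow (- (i.+1)%:Z) t}.
Hypotheses (ff : lfree f) (Kf : model_space alpha = lspan f).
Hypotheses (mD2 : cmeasurable D2) (c2_gt0 : 0 < c2)
  (D2b : forall t, c2 <= sqnorm (D2 t) <= C2).
Hypothesis D2g : forall i, {ae mu, forall t,
  D2 t * L2rep (g i) t = zpow (- (i.+1)%:Z) t}.
Hypotheses (fg : lfree g) (Kg : model_space beta = lspan g).

Lemma f_bounded i : L2bounded (f i).
Proof.
exists c1^-1; apply: filterS (D1f i) => t /(congr1 sqnorm).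
rewrite sqnormM sqnorm_zpow => E; have /andP[h _] := D1b t.
rewrite -[leRHS]mul1r -E ler_pdivlMr// mulrC.
by rewrite ler_wpM2r ?sqnorm_ge0.
Qed.

Lemma model_bounded x : model_space alpha x -> L2bounded x.
Proof. by rewrite Kf => -[c ->]; apply: L2bounded_sum; exact: f_bounded. Qed.

Definition toeplitz_op phi (x : model_space alpha) : L2 R :=
  orthogonal_projection (model_space beta) (mulL2 phi (val x)).

Lemma val_model (x : model_space alpha) : model_space alpha (val x).
Proof. exact: set_mem (valP x). Qed.

(** The graph relation of the operator is that of a total function, because the
    elements of the model space are bounded. *)
Lemma ATTO_toeplitz_op phi (x : model_space alpha) y :
  ATTO beta phi (val x) y <-> y = toeplitz_op phi x.
Proof.
have xb := model_bounded (val_model x); split.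
  move=> [h hE ->]; congr orthogonal_projection; apply: L2_ext.
  by apply: filterS2 hE (L2rep_mulL2 phi xb) => t -> ->.
by move=> ->; exists (mulL2 phi (val x)) => //; exact: L2rep_mulL2.
Qed.

Lemma ATTO_spaceP (A : model_space alpha -> L2 R) :
  ATTO_space alpha beta A <->
  bounded_operator (model_space alpha) (model_space beta) A /\
  exists phi, A = toeplitz_op phi.
Proof.
split=> -[bA [phi H]]; split=> //; exists phi.
  by apply/funext => x; apply: H; apply/ATTO_toeplitz_op.
by move=> x y /ATTO_toeplitz_op ->; rewrite H.
Qed.

Definition toeplitz_entry phi i j := inner_product (mulL2 phi (f i)) (g j).

(** Projecting onto the span of the g_j does not change inner products with
    them, and these inner products determine an element of that span. *)
Lemma toeplitz_op_eq phi psi :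
  (forall i j, toeplitz_entry phi i j = toeplitz_entry psi i j) ->
  toeplitz_op phi = toeplitz_op psi.
Proof.
move=> E; apply/funext => x; rewrite /toeplitz_op Kg; apply: (proj_eq fg) => j.
have := val_model x; move: (val x) => {}x; rewrite Kf => -[c ->].
have L (ph : L2 R) : mulL2 ph (\sum_(i < m.+1) c i *: f i) = \sum_(i < m.+1) c
  i *: mulL2 ph (f i).
  pose P u v := L2bounded u /\ mulL2 ph u = v.
  suff [] : P (\sum_(i < m.+1) c i *: f i) (\sum_(i < m.+1) c i *: mulL2 ph (f
    i)) by [].
  apply: (big_ind2 P); rewrite /P.
  - by split; [exact: L2bounded0|exact: mulL20r].
  - move=> u u' v v' [bu <-] [bv <-]; rewrite -[u]scale1r; split.
      exact: L2bounded_lin.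
    by rewrite mulL2_linr// !scale1r.
  - move=> i _; rewrite -[c i *: f i]addr0; split.
      by apply: L2bounded_lin; [exact: f_bounded|exact: L2bounded0].
    rewrite mulL2_linr ?mulL20r ?addr0//; first exact: f_bounded.
    exact: L2bounded0.
by rewrite !L !inner_suml; apply: eq_bigr => i _;
  rewrite -!/(toeplitz_entry _ _ _) E.
Qed.

Lemma mulL2_suml p (c : 'I_p -> R[i]) (phi : 'I_p -> L2 R) x : L2bounded x ->
  mulL2 (\sum_(k < p) c k *: phi k) x = \sum_(k < p) c k *: mulL2 (phi k) x.
Proof.
move=> xb; elim/big_rec2: _ => [|k u v _ <-]; first exact: mulL20l.
by rewrite mulL2_linl.
Qed.

Lemma toeplitz_op_sum p (c : 'I_p -> R[i]) (phi : 'I_p -> L2 R) :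
  toeplitz_op (\sum_(k < p) c k *: phi k) =
  \sum_(k < p) c k *: toeplitz_op (phi k).
Proof.
apply/funext => x; rewrite fct_sumE /toeplitz_op mulL2_suml; last first.
  exact: model_bounded (val_model x).
rewrite Kg; elim/big_rec2: _ => [|k u v _ <-].
  exact: proj0.
by rewrite (proj_lin fg).
Qed.

Lemma toeplitz_op_bounded phi C :
  {ae mu, forall t, sqnorm (L2rep phi t) <= C} ->
  bounded_operator (model_space alpha) (model_space beta) (toeplitz_op phi).
Proof.
move=> pC; split.
- by move=> x; rewrite /toeplitz_op Kg; have [] := projP fg (mulL2 phi (val x)).
- move=> a x y z E; rewrite /toeplitz_op E mulL2_linr ?Kg ?(proj_lin fg)//.
    exact: model_bounded (val_model x).
  exact: model_bounded (val_model y).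
- exists (Num.sqrt `|C|) => x; rewrite !L2normE -sqrtrM// ler_sqrt; last first.
    by rewrite mulr_ge0 ?sqL2norm_ge0.
  rewrite /toeplitz_op Kg; apply: le_trans (sqL2norm_proj fg _) _.
  apply: sqL2norm_mulL2 => //; last exact: model_bounded (val_model x).
  by apply: filterS pC => t; move/le_trans; apply; exact: ler_norm.
Qed.

(** Since f_i = z^-i f_0 and g_j = z^-j g_0, the product of f_i with the
    conjugate of g_j depends on i and j only through j - i. *)
Lemma fg_shift : {ae mu, forall t, forall i j,
  L2rep (f i) t * (L2rep (g j) t)^*%C =
  zpow (j%:Z - i%:Z) t * (L2rep (f ord0) t * (L2rep (g ord0) t)^*%C)}.
Proof.
have H1 := ae_forall_fin D1f; have H2 := ae_forall_fin D2g.
apply: filterS2 H1 H2 => t H1 H2 i j.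
have nz (D : R -> R[i]) c C : 0 < c -> (forall t, c <= sqnorm (D t) <= C) ->
  D t != 0.
  by move=> c0 /(_ t)/andP[h _]; rewrite -sqnorm_eq0 gt_eqF// (lt_le_trans c0).
have E1 : L2rep (f i) t = zpow (- i%:Z) t * L2rep (f ord0) t.
  apply: (mulfI (nz _ _ _ c1_gt0 D1b)); rewrite mulrCA !H1 -zpowD.
  by congr zpow; rewrite -opprD; congr (- _); rewrite addrC -PoszD add1n.
have E2 : L2rep (g j) t = zpow (- j%:Z) t * L2rep (g ord0) t.
  apply: (mulfI (nz _ _ _ c2_gt0 D2b)); rewrite mulrCA !H2 -zpowD.
  by congr zpow; rewrite -opprD; congr (- _); rewrite addrC -PoszD add1n.
by rewrite E1 E2 conjcM zpowJ opprK zpowD mulrACA [zpow (- _) _ * _]mulrC.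
Qed.

(** For equal values of i - j the integrands agree almost everywhere. *)
Lemma toeplitz_entry_diag phi (i i' : 'I_m.+1) (j j' : 'I_n.+1) :
  (i + j' = i' + j)%N ->
  toeplitz_entry phi i j = toeplitz_entry phi i' j'.
Proof.
move=> E; rewrite /toeplitz_entry !inner_mulL2; try exact: f_bounded.
have cm (k : 'I_m.+1) (l : 'I_n.+1) :
    cmeasurable (fun t => L2rep phi t * L2rep (f k) t * (L2rep (g l) t)^*%C).
  by apply: cmeasurableM; [apply: cmeasurableM|apply: cmeasurableJ];
    exact: cmeasurable_L2rep.
apply: mean_ae; [exact: cm|exact: cm|].
apply: filterS fg_shift => t H; rewrite -!mulrA; congr (_ * _).
rewrite (H i j) (H i' j'); congr (zpow _ _ * _); lia.
Qed.

(** D1 and the conjugate of D2 cancel the denominators of the two bases, so that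
    this symbol gives the Toeplitz matrix with ones on the diagonal
    i - j = k - n and zeros elsewhere. *)
Definition symbol_fun (k : nat) t : R[i] :=
  zpow (k%:Z - n%:Z) t * (D1 t * (D2 t)^*%C).

Definition symbol k : L2 R := toL2 (symbol_fun k).

Lemma symbol_fun_bound k t : sqnorm (symbol_fun k t) <= C1 * C2.
Proof.
rewrite sqnormM sqnorm_zpow mul1r sqnormM sqnormJ.
by apply: ler_pM; rewrite ?sqnorm_ge0//; [case/andP: (D1b t)|case/andP: (D2b
  t)].
Qed.

Lemma L2rep_symbol k : {ae mu, forall t, L2rep (symbol k) t = symbol_fun k t}.
Proof.
apply: L2rep_toL2; apply: (sqint_of_le (C := C1 * C2)); apply: sqint_le_bounded.
  by apply: cmeasurableM; [exact: cmeasurable_zpow|apply: cmeasurableM => //;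
    exact: cmeasurableJ].
exact: symbol_fun_bound.
Qed.

Lemma symbol_bounded k : L2bounded (symbol k).
Proof.
exists (C1 * C2); apply: filterS (L2rep_symbol k) => t ->.
exact: symbol_fun_bound.
Qed.

Lemma toeplitz_entry_symbol k i j :
  toeplitz_entry (symbol k) i j = (k + j == n + i)%N%:R.
Proof.
rewrite /toeplitz_entry inner_mulL2; last exact: f_bounded.
rewrite (mean_ae (G := zpow (k%:Z - n%:Z + (j%:Z - i%:Z)))).
- by rewrite mean_zpow; congr (nat_of_bool _)%:R; lia.
- by apply: cmeasurableM; [apply: cmeasurableM|apply: cmeasurableJ];
    exact: cmeasurable_L2rep.
- exact: cmeasurable_zpow.
- apply: filterS3 (L2rep_symbol k) (D1f i) (D2g j) => t -> E1 E2.
  rewrite /symbol_fun [RHS]zpowD.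
  transitivity (zpow (k%:Z - n%:Z) t * ((D1 t * L2rep (f i) t) * (D2 t * L2rep
    (g j) t)^*%C)).
    have alg (a b c d e : R[i]) : a * (b * c) * d * e = a * ((b * d) * (c * e))
      by ring.
    by rewrite conjcM; exact: alg.
  rewrite E1 E2 zpowJ -zpowD; congr (_ * zpow _ _); lia.
Qed.

Lemma toeplitz_entry_sum p (c : 'I_p -> R[i]) (phi : 'I_p -> L2 R) i j :
  toeplitz_entry (\sum_(k < p) c k *: phi k) i j =
  \sum_(k < p) c k * toeplitz_entry (phi k) i j.
Proof. by rewrite /toeplitz_entry mulL2_suml ?inner_suml//;
  exact: f_bounded. Qed.

Lemma toeplitz_entry0 phi i j : toeplitz_op phi = 0 ->
  toeplitz_entry phi i j = 0.
Proof.
have fi : model_space alpha (f i) by rewrite Kf; exact: lspan_mem.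
move/(congr1 (fun A : model_space alpha -> L2 R =>
  A (exist _ (f i) (mem_set fi)))).
rewrite /toeplitz_op Kg /= => H; rewrite /toeplitz_entry -(inner_proj fg) H.
exact: inner0l.
Qed.

(** The operators given by the m + n + 1 elementary symbols form a basis: they
    have the elementary Toeplitz matrices, and every operator of the space has a
    Toeplitz matrix, hence agrees with one whose symbol is a combination of
    theirs. *)
Lemma ATTO_dimension : has_dimension (ATTO_space alpha beta) (m + n).+1.
Proof.
(* a matrix position on diagonal k: with i = 0 if k <= n, and j = 0 otherwise *)
pose ik (k : 'I_(m + n).+1) : 'I_m.+1 := inord (k - n).
pose jk (k : 'I_(m + n).+1) : 'I_n.+1 := inord (n - k).
have ikE k : ik k = (k - n)%N :> nat by rewrite inordK//; have := ltn_ord k;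
  lia.
have jkE k : jk k = (n - k)%N :> nat by rewrite inordK//; have := ltn_ord k;
  lia.
have entryE (c : 'I_(m + n).+1 -> R[i]) k :
    toeplitz_entry (\sum_(l < (m + n).+1) c l *: symbol l) (ik k) (jk k) = c k.
  rewrite toeplitz_entry_sum (bigD1 k)//= toeplitz_entry_symbol ikE jkE.
  rewrite (_ : _ == _ = true) ?mulr1; last by lia.
  rewrite big1 ?addr0// => l lk; rewrite toeplitz_entry_symbol ikE jkE.
  rewrite (_ : _ == _ = false) ?mulr0//.
  by apply/negbTE; apply: contra lk => /eqP lk; apply/eqP/val_inj => /=; lia.
exists (fun k => toeplitz_op (symbol k)); split.
  move=> c; rewrite -toeplitz_op_sum => H k; rewrite -[LHS](entryE c k).
  exact: toeplitz_entry0.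
apply/seteqP; split => A.
  move=> /ATTO_spaceP[_ [phi ->]].
  exists (fun k => toeplitz_entry phi (ik k) (jk k)); rewrite -toeplitz_op_sum.
  apply: toeplitz_op_eq => i j.
  have kP : (i + (n - j) < (m + n).+1)%N by have := ltn_ord i; lia.
  pose k := Ordinal kP.
  have Eij : (ik k + j = i + jk k)%N.
    by rewrite ikE jkE /=; have := ltn_ord j; lia.
  rewrite -(toeplitz_entry_diag phi Eij) -[LHS](entryE (fun k =>
    toeplitz_entry phi (ik k) (jk k))).
  exact: toeplitz_entry_diag.
move=> [c ->]; apply/ATTO_spaceP; rewrite -toeplitz_op_sum; split;
  last by eexists.
have [C HC] := L2bounded_sum c (fun k => symbol_bounded k).
exact: toeplitz_op_bounded HC.
Qed.

End Operators.

(** * The dimension of the space of truncated Toeplitz operators *)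

Theorem proposition2p1 (R : realType) (alpha beta : R[i] -> R[i]^o) (m n : nat) :
  inner_function alpha -> inner_function beta ->
  (0 < m)%N -> has_dimension (model_space alpha) m ->
  (0 < n)%N -> has_dimension (model_space beta) n ->
  has_dimension (ATTO_space alpha beta) (m + n - 1)%N.
Proof.
case: m n => [|m] [|n]// ina inb _ da _ db.
have [D1 [f [c1 [C1 [[? ? ? ?] [? ?]]]]]] := model_space_basis ina da.
have [D2 [g [c2 [C2 [[? ? ? ?] [? ?]]]]]] := model_space_basis inb db.
rewrite addSn addnS subn1 /=.
exact: (@ATTO_dimension R alpha beta m n D1 D2 f g c1 C1 c2 C2).
Qed.
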